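(* Let $M$ be a manifold. Equip the group $\mathrm{Diff}(M)$ of diffeomorphisms of $M$ with the functional diffeology. Then every smooth monomorphism (injective group homomorphism that is smooth as a map of diffeological spaces) $\rho\colon G\to \mathrm{Diff}(M)$ from a Lie group $G$ to $\mathrm{Diff}(M)$ is an induction; that is, $\rho$ is a diffeomorphism from $G$ onto its image $\rho(G)$, where $\rho(G)$ is equipped with the subset diffeology inherited from $\mathrm{Diff}(M)$.
   Context: All manifolds, and in particular all Lie groups, are smooth, Hausdorff, second countable and finite dimensional. A parametrization on a set $X$ is a map from an open subset of $\mathbf{R}^n$, for some $n\in\mathbf{N}$, to $X$. A diffeology on $X$ is a set of parametrizations, called plots, such that: constant parametrizations are plots; being a plot is a local condition (if every point of the domain of a parametrization has an open neighbourhood on which the restriction is a plot, then the parametrization is a plot); and precomposing a plot with a map that is smooth in the usual sense, between open subsets of Euclidean spaces, gives a plot. A diffeological space is a set with a diffeology. A map between diffeological spaces is smooth if its composition with every plot of the source is a plot of the target; a diffeomorphism is a smooth bijection with smooth inverse. A manifold is given the diffeology whose plots are the parametrizations that are smooth in the usual sense. The functional diffeology on $\mathrm{Diff}(M)$ has as plots the parametrizations $U\to\mathrm{Diff}(M)$, $r\mapsto f_r$, for which $(r,m)\mapsto f_r(m)$, $U\times M\to M$, is smooth. For a Lie group $G$, a homomorphism $\rho\colon G\to\mathrm{Diff}(M)$ is smooth if and only if $(g,m)\mapsto\rho(g)(m)$ is a smooth map $G\times M\to M$. The subset diffeology on a subset $A$ of a diffeological space $X$ consists of the plots of $X$ with values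 in $A$. An induction is an injective smooth map between diffeological spaces that is a diffeomorphism onto its image, where the image carries the subset diffeology. *)

(* Defs.v *)
From HB Require Import structures.
From mathcomp Require Import all_boot all_order all_algebra.
From mathcomp Require Import all_classical all_reals all_analysis.
Set Implicit Arguments.
Unset Strict Implicit.
Unset Printing Implicit Defensive.
Import Order.TTheory GRing.Theory Num.Theory.
Import numFieldNormedType.Exports.
Local Open Scope classical_set_scope.
Local Open Scope ring_scope.

Section smooth_calculus.
Context {R : realType}.
Implicit Types V W : normedModType R.

(* Functions are total; only the germs of f at the points of U matter when U is
   open, which is the only case of interest.  C^(k+1) means Frechet
   differentiable on U with C^k directional derivatives; for finite-dimensional
   V the latter says that x |-> 'd f x is C^k. *)
Fixpoint Ck {V W} (k : nat) (U : set V) (f : V -> W) : Prop :=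
  if k is k'.+1 then
    (forall x, U x -> differentiable f x) /\ (forall v, Ck k' U ('D_v f))
  else forall x, U x -> {for x, continuous f}.

Definition smooth {V W} (U : set V) (f : V -> W) := forall k, Ck k U f.

Definition smooth_near {V W} (x : V) (f : V -> W) :=
  exists2 U, open_nbhs x U & smooth U f.

Lemma differentiable_near_eq V W (f g : V -> W) x :
  (\near x, f x = g x) -> differentiable f x -> differentiable g x.
Proof.
move=> fg df.
have gE : g \o shift x = cst (g x) + 'd f x +o_ (nbhs (0 : V)) id.
  apply/eqaddoP => e e0.
  have /diff_locally/eqaddoP/(_ e e0) := df.
  have : \forall y \near (0 : V), f (y + x) = g (y + x).
    by have := fg; rewrite (near_shift 0) subr0.
  apply: filterS2 => y; rewrite !fctE /= => ->.
  by rewrite (nbhs_singleton fg).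
have cd := diff_continuous df.
apply/diff_locallyP; rewrite (diff_unique cd gE); split => //.
Unshelve. all: by end_near. Qed.

Lemma Ck_sub V W k (A B : set V) (f : V -> W) : A `<=` B -> Ck k B f -> Ck k A f.
Proof.
elim: k f => [|k IH] f AB /=; first by move=> h x /AB; exact: h.
by move=> [h1 h2]; split=> [x /AB|v]; [exact: h1|exact: IH].
Qed.

Lemma Ck_pred V W k (A : set V) (f : V -> W) : Ck k.+1 A f -> Ck k A f.
Proof.
elim: k f => [|k IH] f /= [h1 h2]; last by split=> // v; exact: IH.
by move=> x /h1; exact: differentiable_continuous.
Qed.

Lemma Ck_eq V W k (A : set V) (f g : V -> W) : open A ->
  (forall x, A x -> f x = g x) -> Ck k A f -> Ck k A g.
Proof.
move=> oA; elim: k f g => [|k IH] f g fg /=.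
  move=> cf x Ax; rewrite /= /prop_for /continuous_at -(fg x Ax).
  apply: cvg_trans (cf x Ax); apply: near_eq_cvg.
  by near=> y; apply: fg; near: y; exact: open_nbhs_nbhs.
have fgn x : A x -> \near x, f x = g x.
  by move=> Ax; near=> y; apply: fg; near: y; exact: open_nbhs_nbhs.
move=> [h1 h2]; split=> [x Ax|v].
  by apply: differentiable_near_eq (fgn x Ax) (h1 _ Ax).
by apply: IH (h2 v) => x Ax; exact: near_eq_derive (fgn x Ax).
Unshelve. all: by end_near. Qed.

Lemma Ck_bigcup V W k (A : set V) (f : V -> W) :
  (forall x, A x -> exists2 B, B x & Ck k B f) -> Ck k A f.
Proof.
elim: k f => [|k IH] f h /=; first by move=> x Ax; have [B Bx hB] := h x Ax; exact: hB.
split=> [x Ax|v]; first by have [B Bx [h1 _]] := h x Ax; exact: h1.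
by apply: IH => x Ax; have [B Bx [_ h2]] := h x Ax; exists B => //; exact: h2.
Qed.

Lemma Ck_cst V W k (A : set V) (w : W) : Ck k A (cst w).
Proof.
elim: k w => [|k IH] w /=; first by move=> x _; exact: cst_continuous.
split=> [x _|v]; first exact: differentiable_cst.
have -> : 'D_v (cst w) = cst 0 :> (V -> W) by apply/funext => x; rewrite derive_cst.
exact: IH.
Qed.

Lemma Ck_post V W (W' : normedModType R) k (A : set V) (f : V -> W)
  (L : {linear W -> W'}) : open A -> continuous L -> Ck k A f -> Ck k A (L \o f).
Proof.
move=> oA cL; elim: k f => [|k IH] f /=.
  by move=> cf x Ax; apply: continuous_comp; [exact: cf|exact: cL].
move=> [h1 h2]; split=> [x Ax|v].
  by apply: differentiable_comp; [exact: h1|exact: linear_differentiable].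
apply: Ck_eq (IH _ (h2 v)) => // x Ax.
have df := h1 _ Ax; have dL := linear_differentiable (f x) cL.
have dLf : differentiable (L \o f) x by exact: differentiable_comp.
rewrite /= (deriveE v dLf) (deriveE v df) (diff_comp df dL)/=.
by rewrite (diff_lin (f x) cL).
Qed.

Lemma Ck_lin V W k (A : set V) (L : {linear V -> W}) : continuous L -> Ck k A L.
Proof.
move=> cL; case: k => [|k] /=; first by move=> x _; exact: cL.
split=> [x _|v]; first exact: linear_differentiable.
have -> : 'D_v L = cst (L v).
  apply/funext => x; rewrite deriveE; last exact: linear_differentiable.
  by rewrite diff_lin.
exact: Ck_cst.
Qed.

Lemma CkD V W k (A : set V) (f g : V -> W) : open A ->
  Ck k A f -> Ck k A g -> Ck k A (f \+ g).
Proof.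
move=> oA; elim: k f g => [|k IH] f g /=.
  by move=> cf cg x Ax; apply: cvgD; [exact: cf|exact: cg].
move=> [f1 f2] [g1 g2]; split=> [x Ax|v].
  by apply: differentiableD; [exact: f1|exact: g1].
apply: Ck_eq (IH _ _ (f2 v) (g2 v)) => // x Ax /=.
by rewrite deriveD//; apply: diff_derivable; [exact: f1|exact: g1].
Qed.

Lemma Ck_sum V W k (A : set V) n (f : 'I_n -> V -> W) : open A ->
  (forall i, Ck k A (f i)) -> Ck k A (fun x => \sum_(i < n) f i x).
Proof.
move=> oA; elim: n f => [|n IH] f h.
  rewrite (_ : (fun _ => _) = cst 0); first exact: Ck_cst.
  by apply/funext => x; rewrite big_ord0.
rewrite (_ : (fun _ => _) = (fun x => \sum_(i < n) f (lift ord0 i) x) \+ f ord0).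
  by apply: CkD => //; apply: IH.
by apply/funext => x; rewrite big_ord_recl addrC.
Qed.

Lemma scale_is_bilinear W :
  bilinear_for
    (GRing.Scale.Law.clone _ _ *:%R _) (GRing.Scale.Law.clone _ _ *:%R _)
    (@GRing.scale R W : R -> W -> W).
Proof.
split=> [u'|u] a x y /=.
- by rewrite scalerDl scalerA.
- by rewrite scalerDr !scalerA mulrC.
Qed.

Lemma differentiable_scale V W (a : V -> R) (f : V -> W) x :
  differentiable a x -> differentiable f x ->
  differentiable (fun y => a y *: f y) x /\
  forall v, 'D_v (fun y => a y *: f y) x = 'D_v a x *: f x + a x *: 'D_v f x.
Proof.
move=> da df.
pose bM := bilinear_isBilinear.Build _ _ _ _ _ _ _ (@scale_is_bilinear W).
pose b : {bilinear R -> W -> W} := HB.pack (@GRing.scale R W : R -> W -> W) bM.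
have cb : continuous (fun p : R * W => b p.1 p.2).
  exact: (@scale_continuous _ W).
have dp : differentiable (fun y => (a y, f y)) x by exact: differentiable_pair.
have db := @differentiable_bilin _ _ _ _ b (a x, f x) cb.
have dc : differentiable (fun y => a y *: f y) x.
  exact: (differentiable_comp dp db).
split=> // v; rewrite !deriveE//.
have /= -> := congr1 (fun h => h v) (diff_comp dp db).
rewrite (@diff_bilin _ _ _ _ b _ cb) diff_pair//=.
exact: addrC.
Qed.

Lemma Ck_scale V W k (A : set V) (a : V -> R) (f : V -> W) : open A ->
  Ck k A a -> Ck k A f -> Ck k A (fun y => a y *: f y).
Proof.
move=> oA; elim: k a f => [|k IH] a f.
  by move=> ca cf x Ax; apply: cvgZ; [exact: ca|exact: cf].
move=> ha hf; have [a1 a2] := ha; have [f1 f2] := hf; split=> [x Ax|v].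
  exact: (differentiable_scale (a1 _ Ax) (f1 _ Ax)).1.
apply: (Ck_eq oA) (CkD oA (IH _ _ (a2 v) (Ck_pred hf))
  (IH _ _ (Ck_pred ha) (f2 v))) => x Ax.
by rewrite (differentiable_scale (a1 _ Ax) (f1 _ Ax)).2.
Qed.

Lemma linear_rV_continuous n W (L : {linear 'rV[R]_n -> W}) : continuous L.
Proof.
rewrite (_ : (L : _ -> _) = fun x => \sum_(i < n) x 0 i *: L (delta_mx 0 i)).
  move=> x; apply: (@Ck_sum _ _ 0 setT) => //; first exact: openT.
  move=> i; apply: Ck_scale => //; first exact: openT.
    by move=> y _; exact: coord_continuous.
  exact: Ck_cst.
apply/funext => x; rewrite {1}(row_sum_delta x) linear_sum.
by apply: eq_bigr => i _; rewrite linearZ.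
Qed.

Lemma coord_is_linear n (i : 'I_n) : linear (fun x : 'rV[R]_n => x 0 i).
Proof. by move=> a x y; rewrite !mxE. Qed.

Lemma Ck_coord V n k (A : set V) (f : V -> 'rV[R]_n) i : open A ->
  Ck k A f -> Ck k A (fun x => f x 0 i).
Proof.
move=> oA.
pose lM := GRing.isLinear.Build _ _ _ _ _ (@coord_is_linear n i).
pose L : {linear 'rV[R]_n -> R} := HB.pack (fun x : 'rV[R]_n => x 0 i) lM.
by apply: (@Ck_post _ _ _ _ _ _ L) => //; exact: linear_rV_continuous.
Qed.

Lemma Ck_comp V W n k (A : set V) (B : set 'rV[R]_n) (f : V -> 'rV[R]_n)
  (g : 'rV[R]_n -> W) : open A -> open B -> (forall x, A x -> B (f x)) ->
  Ck k A f -> Ck k B g -> Ck k A (g \o f).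
Proof.
move=> oA oB AB; elim: k g => [|k IH] g.
  move=> cf cg x Ax; apply: continuous_comp; first exact: cf.
  by apply: cg; exact: AB.
move=> hf [g1 g2]; have [f1 f2] := hf; split=> [x Ax|v].
  by apply: differentiable_comp; [exact: f1|exact/g1/AB].
have h : Ck k A (fun x => \sum_(i < n) 'D_v f x 0 i *: 'D_(delta_mx 0 i) g (f x)).
  apply: Ck_sum => // i; apply: Ck_scale => //; first exact: Ck_coord (f2 v).
  by apply: IH (g2 _); exact: Ck_pred.
apply: (Ck_eq oA) h => x Ax.
have df := f1 _ Ax; have dg := g1 _ (AB _ Ax).
have dgf : differentiable (g \o f) x by exact: differentiable_comp.
rewrite (deriveE v dgf) (diff_comp df dg)/= -(deriveE v df).
rewrite [in RHS](row_sum_delta ('D_v f x)) linear_sum.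
by apply: eq_bigr => i _; rewrite linearZ (deriveE _ dg).
Qed.

Lemma smooth_near_eq V W (f g : V -> W) x :
  (\near x, f x = g x) -> smooth_near x f -> smooth_near x g.
Proof.
move=> nfg; have : nbhs x [set y | f y = g y] by [].
rewrite nbhsE; case=> O [oO Ox] fg; case=> U [oU Ux] sf.
exists (U `&` O); first by split=> //; exact: openI.
move=> k; apply: (@Ck_eq _ _ _ _ f); first exact: openI.
  by move=> y [_ /fg].
by apply: Ck_sub (sf k) => y [].
Qed.

Lemma smooth_near_continuous V W (f : V -> W) x :
  smooth_near x f -> {for x, continuous f}.
Proof. by case=> U [_ Ux] /(_ 0%N) cf; exact: cf. Qed.

Lemma open_setI_preimage (X Y : topologicalType) (A : set X) (B : set Y)
  (f : X -> Y) : open A -> open B -> (forall x, A x -> {for x, continuous f}) ->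
  open (A `&` f @^-1` B).
Proof.
move=> oA oB cf; rewrite openE => x [Ax Bx].
apply: filterI; first exact: open_nbhs_nbhs.
by apply: cf => //; exact: open_nbhs_nbhs.
Qed.

Lemma smooth_near_comp V W n (f : V -> 'rV[R]_n) (g : 'rV[R]_n -> W) x :
  smooth_near x f -> smooth_near (f x) g -> smooth_near x (g \o f).
Proof.
case=> A [oA Ax] sf; case=> B [oB Bx] sg.
have oAB : open (A `&` f @^-1` B).
  by apply: open_setI_preimage => // y Ay; exact: (sf 0%N).
exists (A `&` f @^-1` B) => // k.
apply: (@Ck_comp _ _ _ _ _ B) => //; first by move=> y [].
by apply: Ck_sub (sf k) => y [].
Qed.

Lemma smooth_nearP V W (A : set V) (f : V -> W) :
  open A -> smooth A f <-> forall x, A x -> smooth_near x f.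
Proof.
move=> oA; split=> [sf x Ax|h k]; first by exists A.
by apply: Ck_bigcup => x /h[B [_ Bx] sB]; exists B.
Qed.

Lemma smooth_near_lin n W (L : {linear 'rV[R]_n -> W}) x : smooth_near x L.
Proof.
exists setT; first by split=> //; exact: openT.
by move=> k; apply: Ck_lin; exact: linear_rV_continuous.
Qed.

Lemma smooth_near_cst V W (w : W) (x : V) : smooth_near x (cst w).
Proof.
exists setT; first by split=> //; exact: openT.
by move=> k; exact: Ck_cst.
Qed.

Lemma row_mxl_is_linear m n :
  linear (fun y : 'rV[R]_m => row_mx y (0 : 'rV[R]_n)).
Proof. by move=> a y z; rewrite scale_row_mx add_row_mx scaler0 addr0. Qed.

Lemma row_mxr_is_linear m n :
  linear (fun y : 'rV[R]_n => row_mx (0 : 'rV[R]_m) y).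
Proof. by move=> a y z; rewrite scale_row_mx add_row_mx scaler0 addr0. Qed.

Definition row_mxl m n : {linear 'rV[R]_m -> 'rV[R]_(m + n)} :=
  HB.pack (fun y : 'rV[R]_m => row_mx y (0 : 'rV[R]_n))
    (GRing.isLinear.Build _ _ _ _ _ (@row_mxl_is_linear m n)).

Definition row_mxr m n : {linear 'rV[R]_n -> 'rV[R]_(m + n)} :=
  HB.pack (fun y : 'rV[R]_n => row_mx (0 : 'rV[R]_m) y)
    (GRing.isLinear.Build _ _ _ _ _ (@row_mxr_is_linear m n)).

Lemma smooth_near_row_mx V m n (f : V -> 'rV[R]_m) (g : V -> 'rV[R]_n) x :
  smooth_near x f -> smooth_near x g ->
  smooth_near x (fun y => row_mx (f y) (g y)).
Proof.
case=> A [oA Ax] sf; case=> B [oB Bx] sg; have oAB := openI oA oB.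
exists (A `&` B) => // k.
rewrite (_ : (fun _ => _) = (row_mxl m n \o f) \+ (row_mxr m n \o g)).
  apply: CkD => //; apply: Ck_post => //; try exact: linear_rV_continuous.
    by apply: Ck_sub (sf k) => y [].
  by apply: Ck_sub (sg k) => y [].
by apply/funext => y; rewrite /= add_row_mx addr0 add0r.
Qed.

End smooth_calculus.

(* The domain and codomain of a chart are sets and its two directions are total
   functions, which are meaningless outside of these sets. *)
Record chart (R : realType) (n : nat) (M : topologicalType) := Chart {
  chart_dom : set M;
  chart_cod : set 'rV[R]_n;
  chart_fun :> M -> 'rV[R]_n;
  chart_inv : 'rV[R]_n -> M;
  chart_dom_open : open chart_dom;
  chart_cod_open : open chart_cod;
  chart_funS : forall x, chart_dom x -> chart_cod (chart_fun x);
  chart_invS : forall y, chart_cod y -> chart_dom (chart_inv y);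
  chart_funK : forall x, chart_dom x -> chart_inv (chart_fun x) = x;
  chart_invK : forall y, chart_cod y -> chart_fun (chart_inv y) = y;
  chart_fun_continuous : forall x, chart_dom x -> {for x, continuous chart_fun};
  chart_inv_continuous : forall y, chart_cod y -> {for y, continuous chart_inv}
}.

(* A smooth structure is presented by any of its atlases, not necessarily the
   maximal one.  Manifolds are pure of dimension n, n = 0 is allowed, and they
   may be empty. *)
HB.mixin Record isManifold (R : realType) (n : nat) M of Topological M := {
  manifold_hausdorff : hausdorff_space M;
  manifold_second_countable : @second_countable M;
  atlas : set (chart R n M);
  atlas_cover : forall x : M, exists2 c, atlas c & chart_dom c x;
  atlas_compatible : forall c d, atlas c -> atlas d ->
    forall x, chart_dom c x -> chart_dom d x ->
    smooth_near (c x) (d \o chart_inv c)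
}.

#[short(type="manifoldType")]
HB.structure Definition Manifold (R : realType) (n : nat) :=
  {M of isManifold R n M & Topological M}.

Definition smooth_at (R : realType) (m n : nat) (M : manifoldType R m)
    (N : manifoldType R n) (f : M -> N) (x : M) :=
  {for x, continuous f} /\
  forall (c : chart R m M) (d : chart R n N), atlas c -> atlas d ->
    chart_dom c x -> chart_dom d (f x) ->
    smooth_near (c x) (d \o f \o chart_inv c).

Definition smooth_map (R : realType) (m n : nat) (M : manifoldType R m)
    (N : manifoldType R n) (f : M -> N) :=
  forall x, smooth_at f x.

Section euclidean_manifold.
Context {R : realType} {n : nat}.

Lemma rV_second_countable : @second_countable 'rV[R]_n.
Proof.
pose b (qk : 'rV[rat]_n * nat) : set 'rV[R]_n :=
  ball (map_mx ratr qk.1 : 'rV[R]_n) (qk.2.+1%:R^-1 : R).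
exists (range b).
  apply: (sub_countable (card_image_le b setT)); exact: countableP.
split=> [_ [qk _ <-]|x A]; first by apply: ball_open; rewrite invr_gt0.
move=> /nbhs_ballP[e e0 xeA].
have [k ke] : exists k : nat, k.+1%:R^-1 < e / 2.
  by have /ltr_add_invr[k] := divr_gt0 e0 (ltr0Sn R 1); rewrite add0r; exists k.
have q_ex i : exists q : rat, `|x 0 i - ratr q| < k.+1%:R^-1.
  have : x 0 i - k.+1%:R^-1 < x 0 i + k.+1%:R^-1.
    by rewrite ltrD2l gtrN// invr_gt0.
  move=> /rat_in_itvoo[q]; rewrite in_itv/= => /andP[q1 q2].
  by exists q; rewrite ltr_distlC q1 q2.
have [q qP] := choice q_ex.
exists (ball (map_mx ratr (\row_i q i) : 'rV[R]_n) (k.+1%:R^-1)).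
  split; first by exists (\row_i q i, k).
  split=> [|i j]; first by rewrite invr_gt0.
  by rewrite !mxE ord1 /ball/= distrC; exact: qP.
move=> y [_ xy]; apply: xeA; split=> // i j.
have := xy i j; rewrite !mxE ord1 /ball /= => qy.
rewrite (le_lt_trans (ler_distD (ratr (q j)) _ _))// [ltRHS]splitr.
by rewrite ltrD// (lt_trans _ ke)//; exact: qP.
Qed.

Lemma id_continuous_at (T : topologicalType) (x : T) : {for x, continuous (@id T)}.
Proof. exact: cvg_id. Qed.

Definition id_chart : chart R n 'rV[R]_n :=
  @Chart R n 'rV[R]_n setT setT id id openT openT
    (fun _ => id) (fun _ => id) (fun _ _ => erefl) (fun _ _ => erefl)
    (fun x _ => @id_continuous_at _ x) (fun x _ => @id_continuous_at _ x).

Lemma id_chart_cover (x : 'rV[R]_n) : exists2 c, [set id_chart] c & chart_dom c x.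
Proof. by exists id_chart. Qed.

Lemma id_chart_compatible c d : [set id_chart] c -> [set id_chart] d ->
  forall x, chart_dom c x -> chart_dom d x ->
  smooth_near (c x) (d \o chart_inv c).
Proof. by move=> -> -> x _ _; exact: (smooth_near_lin idfun). Qed.

HB.instance Definition _ := isManifold.Build R n 'rV[R]_n
  (@norm_hausdorff _ _) rV_second_countable id_chart_cover id_chart_compatible.

End euclidean_manifold.

Lemma row_mx_continuous (R : realType) (T : topologicalType) m n
  (f : T -> 'rV[R]_m) (g : T -> 'rV[R]_n) x :
  {for x, continuous f} -> {for x, continuous g} ->
  {for x, continuous (fun y => row_mx (f y) (g y))}.
Proof.
move=> cf cg.
rewrite (_ : (fun _ => _) = (fun y => row_mxl m n (f y) + row_mxr m n (g y))).
  apply: cvgD.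
    by apply: (continuous_comp cf); exact: linear_rV_continuous.
  by apply: (continuous_comp cg); exact: linear_rV_continuous.
by apply/funext => y; rewrite /= add_row_mx addr0 add0r.
Qed.

Section product_manifold.
Context {R : realType} {m n : nat}.

Section charts.
Context {M N : topologicalType} (c : chart R m M) (d : chart R n N).

Definition prod_dom := chart_dom c `*` chart_dom d.
Definition prod_cod := [set v : 'rV[R]_(m + n) |
  chart_cod c (lsubmx v) /\ chart_cod d (rsubmx v)].
Definition prod_to_rV (p : M * N) := row_mx (c p.1) (d p.2).
Definition prod_of_rV (v : 'rV[R]_(m + n)) :=
  (chart_inv c (lsubmx v), chart_inv d (rsubmx v)).

Lemma prod_dom_open : open prod_dom.
Proof.
rewrite openE => -[x y] [/= cx dy].
exists (chart_dom c, chart_dom d) => //=.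
by split; apply: open_nbhs_nbhs; split=> //; exact: chart_dom_open.
Qed.

Lemma prod_cod_open : open prod_cod.
Proof.
apply: openI.
  apply: (@open_comp _ _ lsubmx (chart_cod c)); last exact: chart_cod_open.
  by move=> v _; exact: continuous_lsubmx.
apply: (@open_comp _ _ rsubmx (chart_cod d)); last exact: chart_cod_open.
by move=> v _; exact: continuous_rsubmx.
Qed.

Lemma prod_to_rVS p : prod_dom p -> prod_cod (prod_to_rV p).
Proof.
by move=> [? ?]; rewrite /prod_cod/= row_mxKl row_mxKr; split; exact: chart_funS.
Qed.

Lemma prod_of_rVS v : prod_cod v -> prod_dom (prod_of_rV v).
Proof. by move=> [? ?]; split; exact: chart_invS. Qed.

Lemma prod_to_rVK p : prod_dom p -> prod_of_rV (prod_to_rV p) = p.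
Proof.
by case: p => x y [/= ? ?]; rewrite /prod_of_rV row_mxKl row_mxKr/= !chart_funK.
Qed.

Lemma prod_of_rVK v : prod_cod v -> prod_to_rV (prod_of_rV v) = v.
Proof. by move=> [? ?]; rewrite /prod_to_rV/= !chart_invK// hsubmxK. Qed.

Lemma prod_to_rV_continuous p : prod_dom p -> {for p, continuous prod_to_rV}.
Proof.
move=> [? ?]; apply: row_mx_continuous.
  by apply: (continuous_comp cvg_fst); exact: chart_fun_continuous.
by apply: (continuous_comp cvg_snd); exact: chart_fun_continuous.
Qed.

Lemma prod_of_rV_continuous v : prod_cod v -> {for v, continuous prod_of_rV}.
Proof.
move=> [? ?].
have c1 : {for v, continuous (chart_inv c \o lsubmx)}.
  by apply: continuous_comp; [exact: continuous_lsubmx|exact: chart_inv_continuous].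
have c2 : {for v, continuous (chart_inv d \o rsubmx)}.
  by apply: continuous_comp; [exact: continuous_rsubmx|exact: chart_inv_continuous].
exact: cvg_pair c1 c2.
Qed.

Definition prod_chart : chart R (m + n) (M * N)%type :=
  Chart prod_dom_open prod_cod_open prod_to_rVS prod_of_rVS
    prod_to_rVK prod_of_rVK prod_to_rV_continuous prod_of_rV_continuous.

End charts.

Context (M : manifoldType R m) (N : manifoldType R n).

Lemma prod_hausdorff : hausdorff_space (M * N)%type.
Proof.
move=> [x y] [x' y'] cl; congr (_, _); apply: manifold_hausdorff => A B An Bn.
  have [||[u v] [/= [Au _] [Bu _]]] := cl (A `*` setT) (B `*` setT).
  - by exists (A, setT) => //; split=> //; exact: filterT.
  - by exists (B, setT) => //; split=> //; exact: filterT.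
  by exists u.
have [||[u v] [/= [_ Av] [_ Bv]]] := cl (setT `*` A) (setT `*` B).
- by exists (setT, A) => //; split=> //; exact: filterT.
- by exists (setT, B) => //; split=> //; exact: filterT.
by exists v.
Qed.

Lemma prod_second_countable : @second_countable (M * N)%type.
Proof.
have [B cB [oB bB]] := @manifold_second_countable R m M.
have [C cC [oC bC]] := @manifold_second_countable R n N.
pose f (X : set M * set N) := X.1 `*` X.2.
exists (f @` (B `*` C)).
  apply: (sub_countable (card_image_le _ _)); exact: countableX.
split=> [_ [X [BX CX] <-]|[x y] A].
  rewrite openE => -[u v] [Xu Xv]; exists X => //; split.
    by apply: open_nbhs_nbhs; split=> //; exact: oB.
  by apply: open_nbhs_nbhs; split=> //; exact: oC.
move=> [[A1 A2] [/= /bB[X [BX Xx] XA] /bC[Y [CY Yy] YA]] A12].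
exists (X `*` Y); first by split=> //; exists (X, Y).
by move=> [u v] [Xu Yv]; apply: A12; split; [exact: XA|exact: YA].
Qed.

Definition prod_atlas : set (chart R (m + n) (M * N)%type) :=
  [set e | exists c d, [/\ atlas c, atlas d & e = prod_chart c d]].

Lemma prod_atlas_cover (p : M * N) : exists2 e, prod_atlas e & chart_dom e p.
Proof.
case: p => x y; have [c ac cx] := atlas_cover x; have [d ad dy] := atlas_cover y.
by exists (prod_chart c d) => //; exists c, d.
Qed.

Lemma prod_atlas_compatible e e' : prod_atlas e -> prod_atlas e' ->
  forall p, chart_dom e p -> chart_dom e' p ->
  smooth_near (e p) (e' \o chart_inv e).
Proof.
move=> [c [d [ac ad ->]]] [c' [d' [ac' ad' ->]]] [x y] [/= cx dy] [/= cx' dy'].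
apply: smooth_near_row_mx.
  apply: (@smooth_near_comp _ _ _ _ lsubmx (c' \o chart_inv c)).
    exact: smooth_near_lin.
  by rewrite row_mxKl; exact: atlas_compatible.
apply: (@smooth_near_comp _ _ _ _ rsubmx (d' \o chart_inv d)).
  exact: smooth_near_lin.
by rewrite row_mxKr; exact: atlas_compatible.
Qed.

HB.instance Definition _ := isManifold.Build R (m + n) (M * N)%type
  prod_hausdorff prod_second_countable prod_atlas_cover prod_atlas_compatible.

End product_manifold.

Section chart_neighborhoods.
Context {R : realType} {m : nat}.
Context {M : manifoldType R m}.

Lemma chart_inv_cvg (c : chart R m M) x : chart_dom c x ->
  chart_inv c y @[y --> c x] --> x.
Proof.
move=> cx; rewrite -{2}(chart_funK cx).
by apply: chart_inv_continuous; exact: chart_funS.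
Qed.

Lemma chart_dom_nbhs (c : chart R m M) x : chart_dom c x -> nbhs x (chart_dom c).
Proof. by move=> cx; apply: open_nbhs_nbhs; split=> //; exact: chart_dom_open. Qed.

Lemma smooth_at_id (x : M) : smooth_at id x.
Proof.
split=> [|c d ac ad cx dx]; first exact: id_continuous_at.
exact: atlas_compatible.
Qed.

End chart_neighborhoods.

Section smooth_maps.
Context {R : realType} {m n : nat}.
Context {M : manifoldType R m} {N : manifoldType R n}.

Lemma smooth_at_charts (f : M -> N) x (c : chart R m M) (d : chart R n N) :
  {for x, continuous f} -> atlas c -> atlas d ->
  chart_dom c x -> chart_dom d (f x) ->
  smooth_near (c x) (d \o f \o chart_inv c) -> smooth_at f x.
Proof.
move=> cf ac ad cx dfx sf; split=> // c' d' ac' ad' c'x d'fx.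
have sc := atlas_compatible _ _ ac' ac x c'x cx.
have sd := atlas_compatible _ _ ad ad' (f x) dfx d'fx.
have eqx : (c \o chart_inv c') (c' x) = c x by rewrite /= chart_funK.
have h1 : smooth_near (c' x) ((d \o f \o chart_inv c) \o (c \o chart_inv c')).
  by apply: smooth_near_comp => //; rewrite eqx.
have h2 : smooth_near (c' x)
    ((d' \o chart_inv d) \o ((d \o f \o chart_inv c) \o (c \o chart_inv c'))).
  by apply: smooth_near_comp => //; rewrite /= !chart_funK.
apply: smooth_near_eq h2.
have n1 : \forall y \near c' x, chart_dom c (chart_inv c' y).
  exact: chart_inv_cvg c'x _ (chart_dom_nbhs cx).
have n2 : \forall y \near c' x, chart_dom d (f (chart_inv c' y)).
  exact: chart_inv_cvg c'x _ (cf _ (chart_dom_nbhs dfx)).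
apply: filterS2 n1 n2 => y cy dy.
by rewrite /= (chart_funK cy) (chart_funK dy).
Qed.

Lemma smooth_at_eq (f g : M -> N) x :
  (\near x, f x = g x) -> smooth_at f x -> smooth_at g x.
Proof.
move=> fg [cf sf]; have fgx : f x = g x by exact: nbhs_singleton fg.
split=> [|c d ac ad cx dgx].
  rewrite /prop_for /continuous_at -fgx.
  by apply: cvg_trans cf; exact: near_eq_cvg.
apply: smooth_near_eq (sf c d ac ad cx _); last by rewrite fgx.
have : \forall y \near c x, f (chart_inv c y) = g (chart_inv c y).
  exact: chart_inv_cvg cx _ fg.
by apply: filterS => y /= ->.
Qed.

Lemma smooth_at_cst (y : N) (x : M) : smooth_at (cst y) x.
Proof.
split=> [|c d _ _ _ _]; first exact: cst_continuous.
exact: (@smooth_near_cst _ _ _ (d y)).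
Qed.

End smooth_maps.

Lemma smooth_at_rV (R : realType) m n (f : 'rV[R]_m -> 'rV[R]_n) x : smooth_near x f -> smooth_at f x.
Proof.
move=> sf; apply: (smooth_at_charts (M := 'rV[R]_m) (N := 'rV[R]_n)
  (c := id_chart) (d := id_chart)) => //.
exact: smooth_near_continuous.
Qed.

Section smooth_operations.
Context {R : realType} {l m n : nat}.
Context {L : manifoldType R l} {M : manifoldType R m} {N : manifoldType R n}.

Lemma smooth_at_comp (f : L -> M) (g : M -> N) x :
  smooth_at f x -> smooth_at g (f x) -> smooth_at (g \o f) x.
Proof.
move=> [cf sf] [cg sg].
have [c ac cx] := atlas_cover x; have [d ad dfx] := atlas_cover (f x).
have [e ae ex] := atlas_cover (g (f x)).
apply: (smooth_at_charts (c := c) (d := e)) => //; first exact: continuous_comp.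
have h : smooth_near (c x) ((e \o g \o chart_inv d) \o (d \o f \o chart_inv c)).
  apply: smooth_near_comp; first exact: sf.
  by rewrite /= chart_funK//; exact: sg.
apply: smooth_near_eq h.
have : \forall y \near c x, chart_dom d (f (chart_inv c y)).
  exact: chart_inv_cvg cx _ (cf _ (chart_dom_nbhs dfx)).
by apply: filterS => y dy; rewrite /= chart_funK.
Qed.

Lemma smooth_at_fst (p : M * N) : smooth_at fst p.
Proof.
case: p => x y; have [c ac cx] := atlas_cover x; have [d ad dy] := atlas_cover y.
apply: (smooth_at_charts (c := prod_chart c d) (d := c)) => //.
- exact: cvg_fst.
- by exists c, d.
have h : smooth_near (prod_chart c d (x, y)) (lsubmx : 'rV[R]_(m + n) -> _).
  exact: smooth_near_lin.
apply: smooth_near_eq h.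
have pxy : chart_dom (prod_chart c d) (x, y) by [].
near=> v; rewrite /= chart_invK//.
suff [] : chart_cod (prod_chart c d) v by [].
near: v; apply: open_nbhs_nbhs; split; first exact: chart_cod_open.
exact: chart_funS.
Unshelve. all: by end_near. Qed.

Lemma smooth_at_snd (p : M * N) : smooth_at snd p.
Proof.
case: p => x y; have [c ac cx] := atlas_cover x; have [d ad dy] := atlas_cover y.
apply: (smooth_at_charts (c := prod_chart c d) (d := d)) => //.
- exact: cvg_snd.
- by exists c, d.
have h : smooth_near (prod_chart c d (x, y)) (rsubmx : 'rV[R]_(m + n) -> _).
  exact: smooth_near_lin.
apply: smooth_near_eq h.
have pxy : chart_dom (prod_chart c d) (x, y) by [].
near=> v; rewrite /= chart_invK//.
suff [] : chart_cod (prod_chart c d) v by [].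
near: v; apply: open_nbhs_nbhs; split; first exact: chart_cod_open.
exact: chart_funS.
Unshelve. all: by end_near. Qed.

Lemma smooth_at_pair (f : L -> M) (g : L -> N) x :
  smooth_at f x -> smooth_at g x -> smooth_at (fun y => (f y, g y)) x.
Proof.
move=> [cf sf] [cg sg]; have [c ac cx] := atlas_cover x.
have [d ad dx] := atlas_cover (f x); have [e ae ex] := atlas_cover (g x).
apply: (smooth_at_charts (c := c) (d := prod_chart d e)) => //.
- exact: cvg_pair.
- by exists d, e.
by apply: smooth_near_row_mx; [exact: sf|exact: sg].
Qed.

End smooth_operations.

(* A parametrization with domain the open set U is represented by a total
   function together with U; plot_eq makes its values outside of U irrelevant.
   Restricting a parametrization thus amounts to shrinking U. *)
Record diffeology (R : realType) (X : Type) := Diffeology {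
  plot : forall n : nat, set 'rV[R]_n -> ('rV[R]_n -> X) -> Prop;
  plot_open : forall n (U : set 'rV[R]_n) f, plot U f -> open U;
  plot_eq : forall n (U : set 'rV[R]_n) f g,
    (forall r, U r -> f r = g r) -> plot U f -> plot U g;
  plot_cst : forall n (U : set 'rV[R]_n) x, open U -> plot U (cst x);
  plot_local : forall n (U : set 'rV[R]_n) f, open U ->
    (forall r, U r -> exists V, [/\ open_nbhs r V, V `<=` U & plot V f]) ->
    plot U f;
  plot_comp : forall m n (U : set 'rV[R]_m) (V : set 'rV[R]_n) f h,
    plot U f -> open V -> smooth V h -> (forall r, V r -> U (h r)) ->
    plot V (f \o h)
}.

Definition dsmooth (R : realType) (X Y : Type) (D : diffeology R X)
    (E : diffeology R Y) (f : X -> Y) :=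
  forall n (U : set 'rV[R]_n) p, plot D U p -> plot E U (f \o p).

Definition is_diffeomorphism (R : realType) (X Y : Type) (D : diffeology R X)
    (E : diffeology R Y) (f : X -> Y) :=
  exists g : Y -> X, [/\ cancel f g, cancel g f, dsmooth D E f & dsmooth E D g].

Section subset_diffeology.
Context {R : realType} {X : Type} (D : diffeology R X) (A : set X).

Definition subset_plot n (U : set 'rV[R]_n) (f : 'rV[R]_n -> A) := plot D U (set_val \o f).

Lemma subset_plot_open n (U : set 'rV[R]_n) f : subset_plot U f -> open U.
Proof. exact: plot_open. Qed.

Lemma subset_plot_eq n (U : set 'rV[R]_n) f g :
  (forall r, U r -> f r = g r) -> subset_plot U f -> subset_plot U g.
Proof. by move=> fg; apply: plot_eq => r /fg /= ->. Qed.

Lemma subset_plot_cst n (U : set 'rV[R]_n) x : open U -> subset_plot U (cst x).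
Proof. exact: plot_cst. Qed.

Lemma subset_plot_local n (U : set 'rV[R]_n) f : open U ->
  (forall r, U r -> exists V, [/\ open_nbhs r V, V `<=` U & subset_plot V f]) ->
  subset_plot U f.
Proof. exact: plot_local. Qed.

Lemma subset_plot_comp m n (U : set 'rV[R]_m) (V : set 'rV[R]_n) f h :
  subset_plot U f -> open V -> smooth V h -> (forall r, V r -> U (h r)) ->
  subset_plot V (f \o h).
Proof. exact: plot_comp. Qed.

Definition subset_diffeology : diffeology R A :=
  Diffeology subset_plot_open subset_plot_eq subset_plot_cst subset_plot_local subset_plot_comp.

End subset_diffeology.

Section manifold_diffeology.
Context {R : realType} {m : nat} (M : manifoldType R m).

Definition manifold_plot n (U : set 'rV[R]_n) (f : 'rV[R]_n -> M) :=
  open U /\ forall r, U r -> smooth_at f r.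

Lemma manifold_plot_open n (U : set 'rV[R]_n) f : manifold_plot U f -> open U.
Proof. by case. Qed.

Lemma manifold_plot_eq n (U : set 'rV[R]_n) f g :
  (forall r, U r -> f r = g r) -> manifold_plot U f -> manifold_plot U g.
Proof.
move=> fg [oU sf]; split=> // r Ur; apply: smooth_at_eq (sf r Ur).
by apply: filterS fg _; exact: open_nbhs_nbhs.
Qed.

Lemma manifold_plot_cst n (U : set 'rV[R]_n) x : open U -> manifold_plot U (cst x).
Proof. by move=> oU; split=> // r _; exact: smooth_at_cst. Qed.

Lemma manifold_plot_local n (U : set 'rV[R]_n) f : open U ->
  (forall r, U r -> exists V, [/\ open_nbhs r V, V `<=` U & manifold_plot V f]) ->
  manifold_plot U f.
Proof.
by move=> oU h; split=> // r /h[V [[_ Vr] _ [_ sf]]]; exact: sf.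
Qed.

Lemma manifold_plot_comp k n (U : set 'rV[R]_k) (V : set 'rV[R]_n) f h :
  manifold_plot U f -> open V -> smooth V h -> (forall r, V r -> U (h r)) ->
  manifold_plot V (f \o h).
Proof.
move=> [oU sf] oV /(smooth_nearP _ oV) sh VU; split=> // r Vr.
by apply: smooth_at_comp; [apply/smooth_at_rV/sh|exact/sf/VU].
Qed.

Definition manifold_diffeology : diffeology R M :=
  Diffeology manifold_plot_open manifold_plot_eq manifold_plot_cst manifold_plot_local manifold_plot_comp.

End manifold_diffeology.

(* The inverse is data, but Diff_eq shows that it does not affect equality. *)
Record Diff (R : realType) (n : nat) (M : manifoldType R n) := MkDiff {
  Diff_fun :> M -> M;
  Diff_inv : M -> M;
  Diff_funK : cancel Diff_fun Diff_inv;
  Diff_invK : cancel Diff_inv Diff_fun;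
  Diff_fun_smooth : smooth_map Diff_fun;
  Diff_inv_smooth : smooth_map Diff_inv
}.

Section Diff_group.
Context {R : realType} {n : nat} {M : manifoldType R n}.

Lemma Diff_eq (f g : Diff M) : f =1 g -> f = g.
Proof.
move=> /funext; case: f g => [f f' fK fK' sf sf'] [g g' gK gK' sg sg'] /= fg.
have fg' : f' = g'.
  by apply/funext => x; rewrite -[in LHS](gK' x) -[in LHS]fg fK.
by subst g g'; congr MkDiff; exact: Prop_irrelevance.
Qed.

HB.instance Definition _ := gen_eqMixin (Diff M).
HB.instance Definition _ := gen_choiceMixin (Diff M).

Definition Diff_one : Diff M :=
  MkDiff (fun=> erefl) (fun=> erefl) (@smooth_at_id _ _ M) (@smooth_at_id _ _ M).

Definition Diff_V (f : Diff M) : Diff M :=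
  MkDiff (Diff_invK f) (Diff_funK f) (@Diff_inv_smooth _ _ _ f)
    (@Diff_fun_smooth _ _ _ f).

(* The group law of Diff M is composition: (f * g) x = f (g x). *)
Definition Diff_mul (f g : Diff M) : Diff M :=
  @MkDiff R n M (f \o g) (Diff_inv g \o Diff_inv f)
    (can_comp (Diff_funK f) (Diff_funK g))
    (can_comp (Diff_invK g) (Diff_invK f))
    (fun x => smooth_at_comp (@Diff_fun_smooth _ _ _ g x)
      (@Diff_fun_smooth _ _ _ f (g x)))
    (fun x => smooth_at_comp (@Diff_inv_smooth _ _ _ f x)
      (@Diff_inv_smooth _ _ _ g (Diff_inv f x))).

Lemma Diff_mulA : associative Diff_mul.
Proof. by move=> f g h; apply: Diff_eq. Qed.
Lemma Diff_mul1 : left_id Diff_one Diff_mul.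
Proof. by move=> f; apply: Diff_eq. Qed.
Lemma Diff_1mul : right_id Diff_one Diff_mul.
Proof. by move=> f; apply: Diff_eq. Qed.
Lemma Diff_mulV : left_inverse Diff_one Diff_V Diff_mul.
Proof. by move=> f; apply: Diff_eq => x; exact: Diff_funK. Qed.
Lemma Diff_Vmul : right_inverse Diff_one Diff_V Diff_mul.
Proof. by move=> f; apply: Diff_eq => x; exact: Diff_invK. Qed.

HB.instance Definition _ := isGroup.Build (Diff M)
  Diff_mulA Diff_mul1 Diff_1mul Diff_mulV Diff_Vmul.

End Diff_group.

Section functional_diffeology.
Context {R : realType} {m : nat} (M : manifoldType R m).

(* Smoothness of (r, x) |-> f r x on the open submanifold U * M of the product
   manifold 'rV[R]_n * M. *)
Definition functional_plot n (U : set 'rV[R]_n) (f : 'rV[R]_n -> Diff M) :=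
  open U /\
  forall r x, U r -> smooth_at (fun p : 'rV[R]_n * M => f p.1 p.2) (r, x).

Lemma functional_plot_open n (U : set 'rV[R]_n) f : functional_plot U f -> open U.
Proof. by case. Qed.

Lemma functional_plot_eq n (U : set 'rV[R]_n) f g :
  (forall r, U r -> f r = g r) -> functional_plot U f -> functional_plot U g.
Proof.
move=> fg [oU sf]; split=> // r x Ur; apply: smooth_at_eq (sf r x Ur).
exists (U, setT); first by split; [exact: open_nbhs_nbhs|exact: filterT].
by move=> [s y] [/= Us _]; rewrite fg.
Qed.

Lemma functional_plot_cst n (U : set 'rV[R]_n) x : open U -> functional_plot U (cst x).
Proof.
move=> oU; split=> // r y _.
apply: (@smooth_at_comp _ _ _ _ _ _ _ snd x); first exact: smooth_at_snd.
exact: Diff_fun_smooth.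
Qed.

Lemma functional_plot_local n (U : set 'rV[R]_n) f : open U ->
  (forall r, U r -> exists V, [/\ open_nbhs r V, V `<=` U & functional_plot V f]) ->
  functional_plot U f.
Proof.
by move=> oU h; split=> // r x /h[V [[_ Vr] _ [_ sf]]]; exact: sf.
Qed.

Lemma functional_plot_comp k n (U : set 'rV[R]_k) (V : set 'rV[R]_n) f h :
  functional_plot U f -> open V -> smooth V h -> (forall r, V r -> U (h r)) ->
  functional_plot V (f \o h).
Proof.
move=> [oU sf] oV /(smooth_nearP _ oV) sh VU; split=> // r x Vr.
apply: (@smooth_at_comp _ _ _ _ _ _ _
  (fun p : 'rV[R]_n * M => (h p.1, p.2)) (fun p => f p.1 p.2)).
  apply: smooth_at_pair; last exact: smooth_at_snd.
  apply: (@smooth_at_comp _ _ _ _ _ _ _ fst h); first exact: smooth_at_fst.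
  exact/smooth_at_rV/sh.
exact/sf/VU.
Qed.

Definition functional_diffeology : diffeology R (Diff M) :=
  Diffeology functional_plot_open functional_plot_eq functional_plot_cst functional_plot_local functional_plot_comp.

End functional_diffeology.

HB.mixin Record isLieGroup (R : realType) (n : nat) G
    of Manifold R n G & Group G := {
  mulg_smooth : smooth_map (fun p : G * G => (p.1 * p.2)%g);
  invg_smooth : smooth_map (fun x : G => (x^-1)%g)
}.

#[short(type="lieGroupType")]
HB.structure Definition LieGroup (R : realType) (n : nat) :=
  {G of isLieGroup R n G & Manifold R n G & Group G}.

(* f seen as a map onto its image, a type through set_type. *)
Definition corestrict (X Y : Type) (f : X -> Y) (x : X) : range f :=
  SigSub (mem_set (imageT f x)).

Definition is_induction (R : realType) (X Y : Type) (D : diffeology R X)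
    (E : diffeology R Y) (f : X -> Y) :=
  [/\ injective f, dsmooth D E f &
      is_diffeomorphism D (subset_diffeology E (range f)) (corestrict f)].

(* Main.v *)
Require Import Defs.
From HB Require Import structures.
From mathcomp Require Import all_boot all_order all_algebra.
From mathcomp Require Import ring lra.
From mathcomp Require Import all_classical all_reals all_analysis.
Set Implicit Arguments.
Unset Strict Implicit.
Unset Printing Implicit Defensive.
Import Order.TTheory GRing.Theory Num.Theory.
Import numFieldNormedType.Exports.
Local Open Scope classical_set_scope.
Local Open Scope ring_scope.

(** Only the smoothness of the inverse of rho on its image needs an argument:
    if q is a map from an open set of parameters to G such that
    (r, x) |-> rho (q r) x is smooth, then q is smooth ([lift_smooth]).

    Orbit maps separate tangent vectors.  There are n functions on a chart c of
    G, each of them a coordinate of an orbit map u |-> rho (c^-1 u) x_j, whose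
    differentials at some point u0 are linearly independent
    ([action_coords_independent]).  Take local coordinates of G of which as many
    as possible are of this kind.  If one is not, move it alone: along the
    resulting curve the differentials of all coordinates of all orbit maps
    vanish on the velocity, since otherwise one of them could replace the
    coordinate that moves ([frame_exchange]).  So rho g x stays constant for
    every x in M while g moves, which contradicts the injectivity of rho
    ([frame_step]).

    Correction of q.  The implicit function theorem ([implicit_function]) yields
    a smooth k with k r0 = u0 such that, for h r = c^-1 (k r) * q r, the chosen
    coordinates of the points rho (h r * (q r0)^-1) x_j do not depend on r
    ([implicit_correction]).
    The chosen coordinates are injective near u0, uniformly in the points x_j
    ([action_coord_uniformly_injective]), hence the values of h near r0 form a
    discrete subset of G, which is countable because G is second countable.

    Conclusion.  For each x in M the path of points rho (h r) x depends
    continuously on r and takes countably many values, so it is constant on a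
    ball that does not depend on x ([countable_continuous_const]).  By
    injectivity h is constant on that ball, and q r = (c^-1 (k r))^-1 * h r0 is
    smooth. *)

(** * Strict differentiability *)

Section norms.
Context {R : realType}.

Lemma coord_le_norm n (x : 'rV[R]_n) i : `|x 0 i| <= `|x|.
Proof.
rewrite [leRHS]/Num.norm /= mx_normrE.
exact: (le_bigmax _ (fun ij : 'I_1 * 'I_n => `|x ij.1 ij.2|) (ord0, i)).
Qed.

Lemma norm_le_coord n (x : 'rV[R]_n) e :
  0 <= e -> (forall i, `|x 0 i| <= e) -> `|x| <= e.
Proof.
move=> e0 xe; rewrite [leLHS]/Num.norm /= mx_normrE; apply/bigmax_leP; split=> //.
by move=> [i j] _ /=; rewrite ord1.
Qed.

Lemma norm_row_mx m n (x : 'rV[R]_m) (y : 'rV[R]_n) :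
  `|row_mx x y| <= `|x| + `|y|.
Proof.
apply: norm_le_coord => [|i]; first exact: addr_ge0.
rewrite mxE; case: (fintype.split i) => j.
  by rewrite (le_trans (coord_le_norm x j))// lerDl.
by rewrite (le_trans (coord_le_norm y j))// lerDr.
Qed.

Lemma norm_row_mx0 m n (x : 'rV[R]_m) : `|row_mx x (0 : 'rV[R]_n)| <= `|x|.
Proof. by rewrite (le_trans (norm_row_mx _ _))// normr0 addr0. Qed.

Lemma norm_mulmx_le m n (B : 'M[R]_(m, n)) :
  exists2 C, 0 < C & forall u : 'rV[R]_m, `|u *m B| <= C * `|u|.
Proof.
pose S := \sum_i \sum_j `|B i j|.
have S0 : 0 <= S by apply: sumr_ge0 => i _; apply: sumr_ge0.
exists (1 + S); first by rewrite ltr_pwDl.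
move=> u; apply: norm_le_coord => [|j].
  by rewrite mulr_ge0// addr_ge0.
rewrite mxE (le_trans (ler_norm_sum _ _ _))// mulrDl mul1r.
rewrite (@le_trans _ _ (S * `|u|)) ?lerDr// mulr_suml; apply: ler_sum => i _.
rewrite normrM mulrC ler_pM ?coord_le_norm//.
by rewrite (bigD1 j)//= lerDl sumr_ge0.
Qed.

Lemma norm_linear_le m n (L : {linear 'rV[R]_m -> 'rV[R]_n}) :
  exists2 C, 0 < C & forall u : 'rV[R]_m, `|L u| <= C * `|u|.
Proof.
have [C C0 h] := norm_mulmx_le (lin1_mx L).
by exists C => // u; rewrite -(mul_rV_lin1 L).
Qed.

End norms.

Section strict_differentiability.
Context {R : realType}.

Lemma mean_value n (f : 'rV[R]_n -> R) x d w w' :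
  (forall y, ball x d y -> differentiable f y) -> ball x d w -> ball x d w' ->
  exists2 y, ball x d y & f w - f w' = 'd f y (w - w').
Proof.
move=> df xw xw'; pose h := w - w'; pose l (t : R) := w' + t *: h.
have bl (t : R) : 0 <= t -> t <= 1 -> ball x d (l t).
  move=> t0 t1; have e : x - l t = t *: (x - w) + (1 - t) *: (x - w').
    apply/rowP => i; rewrite /l /h !mxE; ring.
  move: xw xw'; rewrite -ball_normE /= => xw xw'.
  rewrite e (le_lt_trans (ler_normD _ _))// !normrZ ger0_norm//.
  rewrite (ger0_norm (x := 1 - t)) ?subr_ge0//.
  move: t0; rewrite le_eqVlt => /predU1P[<-|t0].
    by rewrite mul0r add0r subr0 mul1r.
  have -> : d = t * d + (1 - t) * d by rewrite -mulrDl addrC subrK mul1r.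
  by rewrite ltr_leD ?ltr_pM2l// ler_wpM2l ?subr_ge0// ltW.
have isl (t : R) : is_diff t l (fun s => s *: h).
  rewrite (_ : (fun s => s *: h) = cst 0 + ( *:%R^~ h)); first exact: is_diffD.
  by apply/funext => s /=; rewrite [RHS]add0r.
have isf (t : R) : 0 <= t -> t <= 1 -> is_derive t (1 : R) (f \o l) ('d f (l t) h).
  move=> t0 t1; have dft : differentiable f (l t) by apply/df/bl.
  have dfl : differentiable (f \o l) t.
    by apply: differentiable_comp => //; have [] := isl t.
  apply: DeriveDef; first exact: diff_derivable.
  have [dl lE] := isl t.
  by rewrite (deriveE _ dfl) (diff_comp dl dft) /= lE scale1r.
have [t||t] := @MVT_segment _ (f \o l) (fun t => 'd f (l t) h) 0 1 ler01.
- by rewrite in_itv /= => /andP[/ltW t0 /ltW t1]; exact: isf.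
- apply: derivable_within_continuous => t; rewrite in_itv /= => /andP[t0 t1].
  by have [] := isf t t0 t1.
rewrite in_itv /= => /andP[t0 t1] e; exists (l t); first exact: bl.
move: e; rewrite subr0 mulr1 /= => <-.
rewrite /l scale1r scale0r addr0 /h; congr (f _ - _).
by rewrite addrC subrK.
Qed.


(** By the mean value theorem, continuity of the partial derivatives at x bounds
    the error of the linear approximation uniformly in both points.  The
    contraction, Lipschitz and injectivity estimates below all come from this. *)
Lemma strictly_differentiable n (f : 'rV[R]_n -> R) x : smooth_near x f ->
  forall e, 0 < e -> exists2 d, 0 < d & forall w w',
    ball x d w -> ball x d w' -> `|f w - f w' - 'd f x (w - w')| <= e * `|w - w'|.
Proof.
case=> U oU /(_ 1%N) [df cf] e e0.
have Ux := open_nbhs_nbhs oU; have [_ Ux'] := oU.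
pose e' := e / n.+1%:R; have e'0 : 0 < e' by rewrite divr_gt0.
have fx : \forall y \near x,
    forall i : 'I_n, `|'D_(delta_mx 0 i) f x - 'D_(delta_mx 0 i) f y| < e'.
  suff fi i : \forall y \near x,
      `|'D_(delta_mx 0 i) f x - 'D_(delta_mx 0 i) f y| < e'.
    exact: (filter_forall _ fi).
  by have /cvgrPdist_lt/(_ _ e'0) := cf (delta_mx 0 i) x Ux'.
have /(nbhs_ballP x)[d /= d0 dP] : nbhs x (U `&` (fun y => forall i : 'I_n,
    `|'D_(delta_mx 0 i) f x - 'D_(delta_mx 0 i) f y| < e')).
  exact: filterI.
exists d => // w w' xw xw'.
have [|y xy ->] := @mean_value _ f x d w w' _ xw xw'.
  by move=> y /dP[Uy _]; exact: df.
have [Uy fy] := dP _ xy.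
have dE z : U z -> 'd f z (w - w') =
    \sum_i (w - w') 0 i * 'D_(delta_mx 0 i) f z.
  move=> Uz; rewrite {1}(row_sum_delta (w - w')) linear_sum.
  by apply: eq_bigr => i _; rewrite linearZ /= deriveE//; exact: df.
rewrite !dE// -sumrB (le_trans (ler_norm_sum _ _ _))//.
rewrite (@le_trans _ _ (\sum_(i < n) e' * `|w - w'|))//.
  apply: ler_sum => i _; rewrite -mulrBr normrM mulrC.
  by rewrite ler_pM// ?coord_le_norm// distrC ltW.
rewrite sumr_const card_ord -[leLHS]mulr_natl mulrA ler_wpM2r// /e'.
by rewrite mulrCA ger_pMr// ler_pdivrMr// mul1r ler_nat.
Qed.

Lemma smooth_near_coord n k (f : 'rV[R]_n -> 'rV[R]_k) x i :
  smooth_near x f -> smooth_near x (fun y => f y 0 i).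
Proof.
by case=> U [oU Ux] sf; exists U => // j; apply: Ck_coord => //; exact: sf.
Qed.

Lemma smooth_near_differentiable (V W : normedModType R) (f : V -> W) x :
  smooth_near x f -> differentiable f x.
Proof. by case=> U [_ Ux] /(_ 1%N) [df _]; exact: df. Qed.

Lemma diff_coord n k (f : 'rV[R]_n -> 'rV[R]_k) x v i :
  differentiable f x -> 'd (fun y => f y 0 i) x v = 'd f x v 0 i.
Proof.
move=> df; pose lM := GRing.isLinear.Build _ _ _ _ _ (@coord_is_linear R k i).
pose L : {linear 'rV[R]_k -> R} := HB.pack (fun x : 'rV[R]_k => x 0 i) lM.
have cL : continuous L by exact: linear_rV_continuous.
have -> : (fun y => f y 0 i) = L \o f by [].
have dL := linear_differentiable (f x) cL.
by rewrite (diff_comp df dL) /comp (diff_lin (f x) cL).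
Qed.

Lemma strictly_differentiable_rV n k (f : 'rV[R]_n -> 'rV[R]_k) x :
  smooth_near x f ->
  forall e, 0 < e -> exists2 d, 0 < d & forall w w',
    ball x d w -> ball x d w' -> `|f w - f w' - 'd f x (w - w')| <= e * `|w - w'|.
Proof.
move=> sf e e0; have df := smooth_near_differentiable sf.
have : \forall d \near 0^'+, forall i : 'I_k, forall w w',
    ball x d w -> ball x d w' ->
    `|f w 0 i - f w' 0 i - 'd f x (w - w') 0 i| <= e * `|w - w'|.
  apply: filter_forall => i.
  have [d d0 h] := strictly_differentiable (smooth_near_coord i sf) e0.
  near=> d' => w w' xw xw'; rewrite -diff_coord//; apply: h.
    by apply: le_ball xw; near: d'; exact: nbhs_right_le.
  by apply: le_ball xw'; near: d'; exact: nbhs_right_le.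
move=> fd; near (0 : R)^'+ => d; exists d => // w w' xw xw'.
apply: norm_le_coord => [|i]; first by rewrite mulr_ge0// ltW.
rewrite !mxE; move: i w w' xw xw'; near: d; exact: fd.
Unshelve. all: by end_near. Qed.

End strict_differentiability.

(** * Smoothness of determinants and inverse matrices *)

Section Ck_matrix.
Context {R : realType} {V : normedModType R}.
Variables (k : nat) (A : set V).
Hypothesis oA : open A.

Lemma Ck_mul (a b : V -> R) :
  Ck k A a -> Ck k A b -> Ck k A (fun x => a x * b x).
Proof. exact: Ck_scale. Qed.

Lemma Ck_prod_seq (I : Type) (s : seq I) (f : I -> V -> R) :
  (forall i, Ck k A (f i)) -> Ck k A (fun x => \prod_(i <- s) f i x).
Proof.
move=> h; elim: s => [|i s IH].
  by under eq_fun do rewrite big_nil; exact: Ck_cst.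
by under eq_fun do rewrite big_cons; exact: Ck_mul.
Qed.

Lemma Ck_sum_seq (I : Type) (s : seq I) (f : I -> V -> R) :
  (forall i, Ck k A (f i)) -> Ck k A (fun x => \sum_(i <- s) f i x).
Proof.
move=> h; elim: s => [|i s IH].
  by under eq_fun do rewrite big_nil; exact: Ck_cst.
by under eq_fun do rewrite big_cons; exact: CkD.
Qed.

Lemma Ck_det n (a : V -> 'M[R]_n) :
  (forall i j, Ck k A (fun x => a x i j)) -> Ck k A (fun x => \det (a x)).
Proof.
move=> h; apply: Ck_sum_seq => s; apply: Ck_mul; first exact: Ck_cst.
by apply: Ck_prod_seq => i; exact: h.
Qed.

Lemma Ck_row n (f : V -> 'rV[R]_n) :
  (forall i, Ck k A (fun x => f x 0 i)) -> Ck k A f.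
Proof.
move=> h; rewrite (_ : f = fun x => \sum_(i < n) f x 0 i *: delta_mx 0 i).
  by apply: Ck_sum => // i; apply: Ck_scale => //; exact: Ck_cst.
by apply/funext => x; exact: row_sum_delta.
Qed.

End Ck_matrix.

Section Ck_inverse.
Context {R : realType} {V : normedModType R}.

Lemma Ck_inv k (A : set V) (f : V -> R) : open A ->
  (forall x, A x -> f x != 0) -> Ck k A f -> Ck k A (fun x => (f x)^-1).
Proof.
move=> oA f0; elim: k => [|k IH].
  by move=> cf x Ax; apply: cvgV; [exact: f0|exact: cf].
move=> hf; have [f1 f2] := hf; have fk := IH (Ck_pred hf).
split=> [x Ax|v]; first by apply: differentiableV; [exact: f1|exact: f0].
have h : Ck k A (fun x => (-1 * ((f x)^-1 * (f x)^-1)) * 'D_v f x).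
  exact: (Ck_mul oA (Ck_mul oA (Ck_cst _ _ _) (Ck_mul oA fk fk)) (f2 v)).
apply: (Ck_eq oA) h => x Ax; rewrite deriveV ?f0//; last first.
  by apply: diff_derivable; exact: f1.
by rewrite mulN1r expr2 invfM.
Qed.

(** Cramer's rule. *)
Lemma Ck_invmx n k (A : set V) (a : V -> 'M[R]_n) i j : open A ->
  (forall x, A x -> a x \in unitmx) ->
  (forall i j, Ck k A (fun x => a x i j)) -> Ck k A (fun x => invmx (a x) i j).
Proof.
move=> oA au ha.
have h : Ck k A (fun x => (\det (a x))^-1 * cofactor (a x) j i).
  apply: (Ck_mul oA).
    apply: Ck_inv => //; last exact: (Ck_det oA).
    by move=> x /au; rewrite unitmxE unitfE.
  apply: (Ck_mul oA); first exact: Ck_cst.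
  apply: (Ck_det oA) => i' j'; under eq_fun do rewrite !mxE; exact: ha.
by apply: (Ck_eq oA) h => x Ax; rewrite /invmx au// !mxE.
Qed.

End Ck_inverse.

Section differentiable_criterion.
Context {R : realType}.

Lemma differentiable_from_near m n (f : 'rV[R]_m -> 'rV[R]_n)
    (L : {linear 'rV[R]_m -> 'rV[R]_n}) x :
  (forall e, 0 < e -> \forall h \near (0 : 'rV[R]_m),
    `|f (h + x) - f x - L h| <= e * `|h|) ->
  differentiable f x /\ 'd f x = L :> (_ -> _).
Proof.
move=> fL; have cL : continuous L by exact: linear_rV_continuous.
have fE : f \o shift x = cst (f x) + L +o_ (nbhs (0 : 'rV[R]_m)) id.
  apply/eqaddoP => e e0; apply: filterS (fL e e0) => h.
  by rewrite !fctE /= opprD addrA.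
have dE := diff_unique cL fE; split=> //.
by apply/diff_locallyP; rewrite dE.
Qed.

Lemma near_diff_approx m n (f : 'rV[R]_m -> 'rV[R]_n) x e : differentiable f x ->
  0 < e -> \forall h \near (0 : 'rV[R]_m),
    `|f (h + x) - f x - 'd f x h| <= e * `|h|.
Proof.
move=> /diff_locally/eqaddoP h e0; apply: filterS (h e e0) => y.
by rewrite !fctE /= opprD addrA.
Qed.

End differentiable_criterion.

(** * The implicit function theorem *)

(** The Banach fixed point theorem asks for one structure that is both complete
    and normed. *)
HB.instance Definition _ (R : realType) m n :=
  Uniform_isComplete.Build 'M[R]_(m, n) (@cauchy_cvg _).

Section implicit_function_estimates.
Context {R : realType} {n l : nat}.
Variables (f : 'rV[R]_(n + l) -> 'rV[R]_n) (U : set 'rV[R]_(n + l)).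
Hypotheses (oU : open U) (sf : smooth U f).

(** In the row vector convention, v *m J is the differential of f in the
    direction (v, 0). *)
Definition partial_jacobian w : 'M[R]_n := lin1_mx ('d f w \o row_mxl n l).

Local Notation J := partial_jacobian.

Lemma partial_jacobianE w v : v *m J w = 'd f w (row_mx v 0).
Proof. by rewrite mul_rV_lin1. Qed.

Lemma diff_row_mx w v z :
  'd f w (row_mx v z) = v *m J w + 'd f w (row_mx 0 z).
Proof. by rewrite partial_jacobianE -linearD add_row_mx add0r addr0. Qed.

Lemma Ck_partial_jacobian k i j : Ck k U (fun w => J w i j).
Proof.
have [df h] := sf k.+1.
apply: (Ck_eq oU) (Ck_coord j oU (h (row_mx (delta_mx 0 i) 0))) => w Uw.
by rewrite mxE /= deriveE//; exact: df.
Qed.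

Lemma partial_jacobian_unit_near w : U w -> J w \in unitmx ->
  \forall y \near w, J y \in unitmx.
Proof.
move=> Uw; have uE y : (J y \in unitmx) = (\det (J y) != 0).
  by rewrite unitmxE unitfE.
move=> Ju; have J0 : \det (J w) != 0 by rewrite -(uE w).
have dJ : Ck 0 U (fun y => \det (J y)).
  by apply: (Ck_det oU) => i j; exact: Ck_partial_jacobian.
have cJ : \det (J y) @[y --> w] --> \det (J w) by exact: dJ.
have : \forall y \near w, \det (J y) != 0 by exact: (cvgr_neq0 _ cJ J0).
by apply: filterS => y; rewrite (uE y).
Qed.

Variables (u0 : 'rV[R]_n) (r0 : 'rV[R]_l).
Local Notation w0 := (row_mx u0 r0).
Hypotheses (Uw0 : U w0) (Jw0 : J w0 \in unitmx).

Local Notation B := (invmx (J w0)).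

(** Both estimates express that f differs from its differential L at w0 by a map
    with a small Lipschitz constant e.  The first says that the Newton map
    u |-> u - (f (u, r) - f w0) *m B is a contraction.  For the second, L kills
    the difference of two points of a level set of f up to e times its norm. *)
Lemma implicit_estimates : exists d K : R, [/\ 0 < d, 0 < K,
  forall w, ball w0 d w -> U w /\ J w \in unitmx,
  forall u u' r, ball w0 d (row_mx u r) -> ball w0 d (row_mx u' r) ->
    `|(u - u') - (f (row_mx u r) - f (row_mx u' r)) *m B| <= 2^-1 * `|u - u'| &
  forall u u' r r', ball w0 d (row_mx u r) -> ball w0 d (row_mx u' r') ->
    f (row_mx u r) = f (row_mx u' r') -> `|u - u'| <= K * `|r - r'|].
Proof.
have [C C0 CB] := norm_mulmx_le B.
have [D D0 Df] := norm_linear_le ('d f w0).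
have sw0 : smooth_near w0 f by exists U.
(* B has norm at most C, hence f - L has Lipschitz constant 1/2 once composed
   with B. *)
pose e := 2^-1 / C; have e0 : 0 < e by rewrite divr_gt0.
have [d1 d10 d1P] := strictly_differentiable_rV sw0 e0.
have nU : nbhs w0 U by exact: open_nbhs_nbhs.
have /(nbhs_ballP w0)[d2 /= d20 d2P] :
    nbhs w0 (U `&` [set y | J y \in unitmx]).
  by apply: filterI => //; exact: partial_jacobian_unit_near.
pose d := Num.min d1 d2.
have dd1 : d <= d1 by rewrite ge_min lexx.
have dd2 : d <= d2 by rewrite ge_min lexx orbT.
exists d, (1 + 2 * (C * D)); split.
- by rewrite lt_min d10.
- by rewrite ltr_pwDl// mulr_ge0// mulr_ge0 ?ltW.
- by move=> w /(le_ball dd2)/d2P.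
- move=> u u' r /(le_ball dd1) wu /(le_ball dd1) wu'.
  have := d1P _ _ wu wu'.
  rewrite opp_row_mx add_row_mx subrr -partial_jacobianE => h.
  rewrite -normrN opprB -[X in _ - X](mulmxK Jw0) -mulmxBl.
  rewrite (le_trans (CB _))// (le_trans (ler_wpM2l (ltW C0) h))//.
  rewrite mulrA /e mulrCA divff ?gt_eqF// mulr1 ler_wpM2l//.
  exact: norm_row_mx0.
- move=> u u' r r' /(le_ball dd1) wu /(le_ball dd1) wu' fE.
  have := d1P _ _ wu wu'; rewrite fE subrr sub0r normrN opp_row_mx add_row_mx.
  rewrite diff_row_mx => h.
  have h1 : `|u - u'| <= C * (e * (`|u - u'| + `|r - r'|)) + C * (D * `|r - r'|).
    rewrite -[X in `|X| <= _](mulmxK Jw0 (u - u')).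
    rewrite -[X in X *m B](addrK ('d f w0 (row_mx 0 (r - r')))) mulmxBl.
    rewrite (le_trans (ler_normB _ _))// lerD// (le_trans (CB _))// ler_wpM2l ?(ltW C0)//.
      by rewrite (le_trans h)// ler_wpM2l ?(ltW e0)// norm_row_mx.
    rewrite (le_trans (Df _))// ler_wpM2l ?(ltW D0)//.
    by rewrite (le_trans (norm_row_mx _ _))// normr0 add0r.
  have eC : C * e = 2^-1 by rewrite /e mulrCA divff ?mulr1// gt_eqF.
  move: h1; rewrite (mulrA C e) eC; lra.
Qed.

End implicit_function_estimates.

Section implicit_function_solution.
Context {R : realType} {n l : nat}.
Variables (f : 'rV[R]_(n + l) -> 'rV[R]_n) (U : set 'rV[R]_(n + l)).
Hypotheses (oU : open U) (sf : smooth U f).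
Local Notation J := (partial_jacobian f).
Variables (u0 : 'rV[R]_n) (r0 : 'rV[R]_l).
Local Notation w0 := (row_mx u0 r0).
Hypotheses (Uw0 : U w0) (Jw0 : J w0 \in unitmx).
Local Notation B := (invmx (J w0)).

(** Simplified Newton iteration: for r near r0 the Newton map with the fixed
    slope B is a contraction of a closed ball around u0 to itself, and B is
    invertible, so that its fixed points solve the equation. *)
Lemma implicit_solution (d : R) :
  0 < d ->
  (forall u u' r, ball w0 d (row_mx u r) -> ball w0 d (row_mx u' r) ->
    `|(u - u') - (f (row_mx u r) - f (row_mx u' r)) *m B| <= 2^-1 * `|u - u'|) ->
  exists2 O : set 'rV[R]_l, open_nbhs r0 O & forall r, O r ->
    exists2 u, ball w0 d (row_mx u r) & f (row_mx u r) = f w0.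
Proof.
move=> d0 est; have [C C0 CB] := norm_mulmx_le B.
pose D := d / 2; have D0 : 0 < D by rewrite divr_gt0.
have bd u r : `|u0 - u| <= D -> `|r0 - r| < D -> ball w0 d (row_mx u r).
  rewrite -ball_normE /= opp_row_mx add_row_mx => uD rD.
  rewrite (le_lt_trans (norm_row_mx _ _))// (splitr d) -/D.
  by rewrite ler_ltD.
have cf : {for r0, continuous (fun r => f (row_mx u0 r))}.
  apply: (@continuous_comp _ _ _ (fun r => row_mx u0 r) f).
    by apply: row_mx_continuous; [exact: cst_continuous|exact: id_continuous_at].
  exact: (sf 0%N).
have e0 : 0 < D / 2 / C by rewrite !divr_gt0.
have n1 : \forall r \near r0, `|f w0 - f (row_mx u0 r)| < D / 2 / C.
  by have /cvgrPdist_lt/(_ _ e0) := cf.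
have n2 : nbhs r0 (ball r0 D) by exact: nbhsx_ballx.
have /nbhs_ballP[t /= t0 tP] :
  nbhs r0 (ball r0 D `&` [set r | `|f w0 - f (row_mx u0 r)| < D / 2 / C]).
  exact: filterI n2 n1.
exists (ball r0 t); first by split; [exact: ball_open|exact: ballxx].
move=> r /tP[]; rewrite -{1}ball_normE /= => rD fr.
pose S := [set u : 'rV[R]_n | `|u0 - u| <= D].
pose H u := u - (f (row_mx u r) - f w0) *m B.
have HH u u' : S u -> S u' -> `|H u - H u'| <= 2^-1 * `|u - u'|.
  move=> Su Su'; rewrite /H (_ : _ - _ =
    (u - u') - (f (row_mx u r) - f (row_mx u' r)) *m B).
    by apply: est; apply: bd.
  rewrite !mulmxBl; apply/rowP => i; rewrite ![in LHS]mxE ![in RHS]mxE; ring.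
have Hu0 : `|u0 - H u0| <= D / 2.
  rewrite /H opprB addrC subrK (le_trans (CB _))//.
  by rewrite distrC mulrC -ler_pdivlMr// ltW.
have S0 : S u0 by rewrite /S /= subrr normr0 ltW.
have HS : {homo H : u / S u >-> S u}.
  move=> u Su; rewrite /S /=.
  have -> : u0 - H u = (u0 - H u0) + (H u0 - H u) by rewrite addrA subrK.
  rewrite (le_trans (ler_normD _ _))// (splitr D) lerD//.
  by rewrite (le_trans (HH _ _ S0 Su))// mulrC ler_wpM2r.
have ctr : is_contraction (mkfun_fun HS).
  exists (2^-1)%:nng; split => /=; first by rewrite invf_lt1// ltr1n.
  by move=> [u u'] [/= Su Su']; exact: HH.
have clS : closed S.
  have -> : S = closed_ball u0 D by rewrite closed_ballE.
  exact: closed_ball_closed.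
have [|u Su] := banach_fixed_point ctr clS; first by exists u0.
move=> uH'; have {uH'} uH : u = H u := uH'; exists u; first exact: bd.
have : (f (row_mx u r) - f w0) *m B *m J w0 = 0.
  have -> : (f (row_mx u r) - f w0) *m B = u - H u by rewrite /H subKr.
  by rewrite -uH subrr mul0mx.
by rewrite mulmxKV// => /eqP; rewrite subr_eq0 => /eqP.
Qed.


Section solution_smooth.
Variables (d K : R) (O : set 'rV[R]_l) (g : 'rV[R]_l -> 'rV[R]_n).
Hypotheses (oO : open O) (K0 : 0 < K).
Hypothesis dU : forall w, ball w0 d w -> U w /\ J w \in unitmx.
Hypothesis gd : forall r, O r -> ball w0 d (row_mx (g r) r).
Hypothesis gf : forall r, O r -> f (row_mx (g r) r) = f w0.
Hypothesis gK : forall r r', O r -> O r' -> `|g r - g r'| <= K * `|r - r'|.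

Let W r := row_mx (g r) r.

(** Expand f (g r, r) = f w0 to first order; the Lipschitz bound on g makes the
    remainder negligible with respect to the increment of r. *)
Lemma implicit_derive r v : O r -> differentiable g r /\
  'D_v g r = - 'D_(row_mx 0 v) f (W r) *m invmx (J (W r)).
Proof.
move=> Or; have [Uw Jw] := dU (gd Or).
have df : differentiable f (W r) by have [df _] := sf 1%N; exact: df.
pose A := invmx (J (W r)); have [C C0 CA] := norm_mulmx_le A.
pose L : {linear 'rV[R]_l -> 'rV[R]_n} := mulmxr (- A) \o 'd f (W r) \o row_mxr n l.
have LE h : L h = - 'd f (W r) (row_mx 0 h) *m A by rewrite /L /= mulmxN mulNmx.
suff [dg dgE] : differentiable g r /\ 'd g r = L :> (_ -> _).
  by split=> //; rewrite deriveE// dgE LE [X in _ = - X *m _]deriveE.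
apply: differentiable_from_near => e e0.
have K1 : 0 < K + 1 by rewrite addr_gt0.
have e1 : 0 < e / (C * (K + 1)) by rewrite divr_gt0// mulr_gt0.
have /nbhs_ballP[t /= t0 tP] := near_diff_approx df e1.
have nO : \forall h \near (0 : 'rV[R]_l), O (h + r).
  have : \forall y \near r, O y by exact: open_nbhs_nbhs.
  by rewrite (near_shift 0) subr0.
have nt : nbhs (0 : 'rV[R]_l) (ball 0 (t / (K + 1))).
  by apply: nbhsx_ballx; rewrite divr_gt0.
apply: filterS2 nO nt => h Oh.
rewrite -ball_normE /= sub0r normrN => ht.
pose k := row_mx (g (h + r) - g r) h.
have kh : `|k| <= (K + 1) * `|h|.
  rewrite (le_trans (norm_row_mx _ _))// mulrDl mul1r lerD2r.
  by rewrite (le_trans (gK Oh Or))// addrK.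
have := tP k; rewrite -ball_normE /= sub0r normrN.
have kW : k + W r = W (h + r) by rewrite /k /W add_row_mx subrK.
rewrite kW /W !gf// subrr sub0r normrN -/(W r).
rewrite (le_lt_trans kh) => [/(_ isT) fk|]; last by rewrite mulrC -ltr_pdivlMr.
have -> : g (h + r) - g r - L h = 'd f (W r) k *m A.
  by rewrite diff_row_mx mulmxDl mulmxK// LE mulNmx opprK.
rewrite (le_trans (CA _))// (le_trans (ler_wpM2l (ltW C0) fk))//.
rewrite (le_trans (ler_wpM2l (ltW C0) (ler_wpM2l (ltW e1) kh)))//.
rewrite !mulrA ler_wpM2r// le_eqVlt; apply/orP; left; apply/eqP.
by field; rewrite !gt_eqF.
Qed.

(** Bootstrapping: the formula for the derivative of g involves g, but none of its
    derivatives, so it is C^k as soon as g is. *)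
Lemma implicit_smooth : smooth O g.
Proof.
have oB : open (ball w0 d) by exact: ball_open.
elim=> [|k IH] /=.
  move=> r Or; apply: differentiable_continuous.
  by have [] := implicit_derive 0 Or.
split=> [r Or|v]; first by have [] := implicit_derive 0 Or.
pose P w := - 'D_(row_mx 0 v) f w *m invmx (J w).
have sP : Ck k (ball w0 d) P.
  apply: (Ck_row oB) => j; rewrite /P.
  under eq_fun do rewrite mxE.
  apply: (Ck_sum_seq oB) => i; apply: (Ck_mul oB).
    have [_ h] := sf k.+1.
    have h1 : Ck k (ball w0 d) (fun w => -1 * 'D_(row_mx 0 v) f w 0 i).
      apply: (Ck_mul oB); first exact: Ck_cst.
      by apply: (Ck_coord i oB); apply: Ck_sub (h _) => w /dU[].
    by apply: (Ck_eq oB) h1 => w _; rewrite mulN1r mxE.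
  apply: (Ck_invmx _ _ oB) => [w /dU[]//|i' j'].
  by apply: (@Ck_sub _ _ _ _ _ U) (Ck_partial_jacobian oU sf k i' j') => w /dU[].
have sW : Ck k O W.
  rewrite (_ : W = (row_mxl n l \o g) \+ row_mxr n l).
    apply: (CkD oO); first by apply: (Ck_post oO) => //; exact: linear_rV_continuous.
    by apply: Ck_lin; exact: linear_rV_continuous.
  by apply/funext => r; rewrite /= add_row_mx addr0 add0r.
apply: (Ck_eq oO) (Ck_comp oO oB gd sW sP) => r Or.
by have [_ ->] := implicit_derive v Or.
Qed.

End solution_smooth.

End implicit_function_solution.

Section implicit_function_theorem.
Context {R : realType} {n l : nat}.

Theorem implicit_function (f : 'rV[R]_(n + l) -> 'rV[R]_n) u0 r0 :
  smooth_near (row_mx u0 r0) f ->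
  (forall v, 'd f (row_mx u0 r0) (row_mx v 0) = 0 -> v = 0) ->
  exists g : 'rV[R]_l -> 'rV[R]_n, [/\ smooth_near r0 g, g r0 = u0 &
    \forall r \near r0, f (row_mx (g r) r) = f (row_mx u0 r0)].
Proof.
case=> U [oU Uw0] sf inj.
have Jw0 : partial_jacobian f (row_mx u0 r0) \in unitmx.
  rewrite -row_free_unit; apply: inj_row_free => v.
  by rewrite partial_jacobianE; exact: inj.
have [d [K [d0 K0 dU est1 est2]]] := implicit_estimates oU sf Uw0 Jw0.
have [V [oV Vr0] Vsol] := implicit_solution sf Uw0 Jw0 d0 est1.
pose w0 := row_mx u0 r0.
pose g r := xget u0 [set u | ball w0 d (row_mx u r) /\ f (row_mx u r) = f w0].
have gP r : V r -> ball w0 d (row_mx (g r) r) /\ f (row_mx (g r) r) = f w0.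
  move=> /Vsol[u ud fu]; rewrite /g.
  apply: (@xgetPex _ u0
    [set u | ball w0 d (row_mx u r) /\ f (row_mx u r) = f w0]).
  by exists u.
have sg : smooth V g.
  apply: (implicit_smooth oU sf oV K0 dU) => [r /gP[]//|r /gP[]//|].
  move=> r r' /gP[gd gf] /gP[gd' gf']; apply: est2 => //.
  by rewrite gf gf'.
exists g; split; first by exists V.
  have [gd gf] := gP _ Vr0.
  apply/eqP; rewrite -subr_eq0 -normr_le0.
  have := est2 _ _ _ _ gd (ballxx _ d0) gf.
  by rewrite subrr normr0 mulr0.
have : nbhs r0 V by exact: open_nbhs_nbhs.
by apply: filterS => r /gP[].
Qed.

End implicit_function_theorem.

(** * Paths with locally constant coordinates *)

Section constant.
Context {R : realType}.

Lemma locally_constant_segment (T : Type) (g : R -> T) (a b : R) : a <= b ->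
  (forall t, a <= t <= b -> \forall s \near t, g s = g t) -> g b = g a.
Proof.
move=> ab lc; pose E := [set t | g t = g a].
have : `[a, b]%classic `&` E = `[a, b]%classic.
  apply: segment_connected.
  - by exists a; split=> //=; rewrite in_itv /= lexx ab.
  - exists (interior E); first exact: open_interior.
    apply/seteqP; split=> t [tab tE]; split=> //; last exact: interior_subset.
    rewrite /interior /=; have /lc : a <= t <= b by move: tab; rewrite /= in_itv.
    by apply: filterS => s; rewrite tE.
  - exists (~` interior (~` E)); first by apply: open_closedC; exact: open_interior.
    apply/seteqP; split=> t [tab tE]; split=> //.
      by move=> /interior_subset; exact.
    apply: contrapT => nE; apply: tE.
    rewrite /interior /=; have /lc : a <= t <= b by move: tab; rewrite /= in_itv.
    by apply: filterS => s sE; rewrite /= /E /= sE.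
move=> /seteqP[_ /(_ b)] /=; rewrite in_itv /= lexx ab => /(_ isT)[_].
by [].
Qed.

(** Otherwise, by the intermediate value theorem, the image contains an interval
    of positive length, which is uncountable. *)
Lemma countable_continuous_segment (h : R -> R) (a b : R) : a <= b ->
  {within `[a, b], continuous h} -> countable (h @` `[a, b]) -> h b = h a.
Proof.
move=> ab ch cth; apply: contrapT => /eqP hab.
pose p := Num.min (h a) (h b); pose q := Num.max (h a) (h b).
have pq : p < q.
  by rewrite /p /q; move: hab; rewrite neq_lt => /orP[] ?;
    [rewrite min_r ?max_l ?ltW|rewrite min_l ?max_r ?ltW].
have : countable `[p, q]%classic.
  apply: sub_countable cth; apply: subset_card_le => v /=.
  by rewrite in_itv /= => /(IVT ab ch)[c cab <-]; exists c.
move=> /countable_lebesgue_measure0; rewrite lebesgue_measure_itv /= lte_fin pq.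
by rewrite -EFinD => -[] /eqP; rewrite subr_eq0 gt_eqF.
Qed.

Lemma zero_derivative_segment (h : R -> R) (a b : R) : a <= b ->
  (forall t, a <= t <= b -> is_derive t (1 : R) h 0) -> h b = h a.
Proof.
move=> ab dh; have [t||t _] := @MVT_segment _ h (fun=> 0) a b ab.
- by rewrite in_itv /= => /andP[/ltW ? /ltW ?]; apply: dh; apply/andP.
- apply: derivable_within_continuous => t; rewrite in_itv /= => /dh.
  by case.
- by rewrite mul0r => /eqP; rewrite subr_eq0 => /eqP.
Qed.

Variables (m : nat) (M : manifoldType R m).

(** Reduces local constancy of a path in M to a statement about its coordinates
    in a chart, which may be examined on intervals where the path stays in the
    domain of the chart. *)
Lemma path_locally_constant (f : R -> M) (c : chart R m M) t :
  chart_dom c (f t) -> {for t, continuous f} ->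
  (exists2 e, 0 < e & forall a b i, a <= b ->
    (forall s, a <= s <= b -> ball t e s /\ chart_dom c (f s)) ->
    c (f b) 0 i = c (f a) 0 i) ->
  \forall s \near t, f s = f t.
Proof.
move=> cft ft [e1 e10 he1].
have : \forall s \near t, chart_dom c (f s).
  by apply: ft; exact: chart_dom_nbhs.
move=> /nbhs_ballP[d /= d0 dP].
pose e := Num.min d e1; have e0 : 0 < e by rewrite lt_min d0.
have ed : e <= d by rewrite ge_min lexx.
have ee1 : e <= e1 by rewrite ge_min lexx orbT.
have he : forall a b i, a <= b ->
    (forall s, a <= s <= b -> ball t e s /\ chart_dom c (f s)) ->
    c (f b) 0 i = c (f a) 0 i.
  move=> a b i ab H; apply: he1 => // s /H[ts cs]; split=> //.
  exact: le_ball ts.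
apply/nbhs_ballP; exists e => // s ts.
have cfs : chart_dom c (f s) by apply: dP; exact: le_ball ts.
rewrite -(chart_funK cfs) -(chart_funK cft); congr (chart_inv c _).
move: ts; rewrite -ball_normE /= ltr_distlC => /andP[s1 s2].
apply/rowP => i; have [st|st] := leP s t.
  apply/esym/he => // u /andP[u1 u2]; have tu : ball t e u.
    rewrite -ball_normE /= ltr_distlC; apply/andP; split; lra.
  by split=> //; apply: dP; exact: le_ball tu.
apply: he (ltW st) _ => u /andP[u1 u2]; have tu : ball t e u.
  rewrite -ball_normE /= ltr_distlC; apply/andP; split; lra.
by split=> //; apply: dP; exact: le_ball tu.
Qed.

(** The ball on which f is constant is the one on which it is assumed to be
    continuous with countable image; when f depends on a further parameter it can
    therefore be chosen independently of that parameter. *)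
Lemma countable_continuous_const l (f : 'rV[R]_l -> M) r0 d :
  (forall r, ball r0 d r -> {for r, continuous f}) ->
  countable (f @` ball r0 d) -> forall r, ball r0 d r -> f r = f r0.
Proof.
move=> cf ctf r rd.
pose g (t : R) := r0 + t *: (r - r0).
have gb t : 0 <= t <= 1 -> ball r0 d (g t).
  move=> /andP[t0 t1]; move: rd; rewrite -!ball_normE /= => rd.
  rewrite /g opprD addNKr normrN normrZ ger0_norm// (le_lt_trans _ rd)//.
  by rewrite distrC ler_piMl.
have cg : continuous g.
  move=> t; apply: cvgD; first exact: cvg_cst.
  by apply: cvgZr_tmp.
have := @locally_constant_segment _ (f \o g) 0 1 ler01.
rewrite /= /g scale1r scale0r addr0 (addrC r0) subrK; apply=> t t01.
have [c ac cx] := atlas_cover (f (g t)).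
have fgt s : ball r0 d (g s) -> {for s, continuous (f \o g)}.
  by move=> ?; apply: continuous_comp; [exact: cg|exact: cf].
have /nbhs_ballP[e /= e0 eP] : \forall s \near t, ball r0 d (g s).
  apply: cg; apply: open_nbhs_nbhs; split; [exact: ball_open|exact: gb].
apply: (@path_locally_constant (f \o g) c t cx (fgt t (gb t t01))).
exists e => // a b i ab H.
apply: (@countable_continuous_segment (fun s => c (f (g s)) 0 i)) => //.
  apply: continuous_in_subspaceT => s; rewrite inE /= in_itv /= => /H[ts cs].
  apply: (@continuous_comp _ _ _ (f \o g) (fun y => c y 0 i)); first exact/fgt/eP.
  apply: (@continuous_comp _ _ _ c (fun y : 'rV[R]_m => y 0 i)).
    exact: chart_fun_continuous.
  exact: coord_continuous.
have cc : countable ((fun y => c y 0 i) @` (f @` ball r0 d)).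
  by apply: sub_countable ctf; exact: card_image_le.
apply: sub_countable cc; apply: subset_card_le => _ [s /= sab <-].
exists (f (g s)) => //; exists (g s) => //; apply: eP.
by move: sab; rewrite in_itv => /H[].
Qed.

End constant.

(** * Charts and the action map *)

Section smooth_near_extra.
Context {R : realType}.

Lemma smooth_near_near (V W : normedModType R) (x : V) (f : V -> W) :
  smooth_near x f -> \forall y \near x, smooth_near y f.
Proof.
case=> U oUx sf; have : nbhs x U by exact: open_nbhs_nbhs.
by apply: filterS => y Uy; exists U => //; case: oUx.
Qed.

Lemma smooth_near_row (V : normedModType R) n (f : V -> 'rV[R]_n) x :
  (forall i, smooth_near x (fun y => f y 0 i)) -> smooth_near x f.
Proof.
move=> h.
have h' i : exists U, open_nbhs x U /\ smooth U (fun y => f y 0 i).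
  by have [U oU sU] := h i; exists U.
have [U hU] := choice h'.
have : nbhs x [set y | forall i, U i y].
  suff nU i : \forall y \near x, U i y by exact: (filter_forall _ nU).
  exact: open_nbhs_nbhs (hU i).1.
rewrite nbhsE => -[D [oD Dx] DU].
exists D => // k; apply: (Ck_row oD) => i.
by apply: Ck_sub ((hU i).2 k) => y /DU; exact.
Qed.

End smooth_near_extra.

Section smooth_charts.
Context {R : realType} {m : nat} {M : manifoldType R m}.

Lemma smooth_at_chart (c : chart R m M) x :
  atlas c -> chart_dom c x -> smooth_at (c : M -> 'rV[R]_m) x.
Proof.
move=> ac cx.
apply: (smooth_at_charts (N := 'rV[R]_m) (c := c) (d := id_chart)) => //.
  exact: chart_fun_continuous.
have : smooth_near (c x) (@idfun 'rV[R]_m) by exact: smooth_near_lin.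
apply: smooth_near_eq.
have : nbhs (c x) (chart_cod c).
  by apply: open_nbhs_nbhs; split; [exact: chart_cod_open|exact: chart_funS].
by apply: filterS => y cy /=; rewrite chart_invK.
Qed.

Lemma smooth_at_chart_inv (c : chart R m M) y :
  atlas c -> chart_cod c y -> smooth_at (chart_inv c) y.
Proof.
move=> ac cy.
apply: (smooth_at_charts (M := 'rV[R]_m) (c := id_chart) (d := c)) => //.
- exact: chart_inv_continuous.
- exact: chart_invS.
have : smooth_near y (@idfun 'rV[R]_m) by exact: smooth_near_lin.
apply: smooth_near_eq.
have : nbhs y (chart_cod c).
  by apply: open_nbhs_nbhs; split; [exact: chart_cod_open|].
by apply: filterS => z cz /=; rewrite chart_invK.
Qed.

Lemma smooth_at_chart_coord k (f : 'rV[R]_k -> M) x (d : chart R m M) i :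
  atlas d -> chart_dom d (f x) -> smooth_at f x ->
  smooth_near x (fun y => d (f y) 0 i).
Proof.
move=> ad dx [_ sf]; have /= h := sf id_chart d erefl ad I dx.
exact: (smooth_near_coord i h).
Qed.

End smooth_charts.

Section action.
Context {R : realType} {m n : nat} {M : manifoldType R m} {G : lieGroupType R n}.
Variable rho : {multiplicative G -> Diff M}.
Hypothesis srho : dsmooth (manifold_diffeology G) (functional_diffeology M) rho.

Definition act (p : G * M) : M := rho p.1 p.2.

Lemma act_mul g h x : act ((g * h)%g, x) = act (g, act (h, x)).
Proof. by rewrite /act /= gmulfM. Qed.

(** The inverse of a chart of G is a plot. *)
Lemma act_smooth : smooth_map act.
Proof.
move=> [g x]; have [c ac cg] := atlas_cover g.
have [_ h] := srho (conj (@chart_cod_open _ _ _ c)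
  (fun y => @smooth_at_chart_inv _ _ _ c y ac)).
have {}h := h (c g) x (chart_funS cg).
have s1 : smooth_at (fun p : G * M => (c p.1, p.2)) (g, x).
  apply: smooth_at_pair; last exact: smooth_at_snd.
  apply: (@smooth_at_comp _ _ _ _ _ _ _ fst (c : G -> 'rV[R]_n)).
    exact: smooth_at_fst.
  exact: smooth_at_chart.
apply: smooth_at_eq (smooth_at_comp s1 h).
have : nbhs (g, x) (fst @^-1` (chart_dom c)).
  by apply: cvg_fst; exact: chart_dom_nbhs.
by apply: filterS => -[g' x'] /= cg'; rewrite /act /= chart_funK.
Qed.

Lemma act_smooth_comp k (a : 'rV[R]_k -> G) (b : 'rV[R]_k -> M) y :
  smooth_at a y -> smooth_at b y -> smooth_at (fun z => act (a z, b z)) y.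
Proof.
move=> sa sb; apply: (@smooth_at_comp _ _ _ _ _ _ _ (fun z => (a z, b z)) act).
  exact: smooth_at_pair.
exact: act_smooth.
Qed.

End action.

(** * Orbit maps separate tangent vectors *)

Section diff_linear.
Context {R : realType}.

Lemma diff_comp_linear p q k (f : 'rV[R]_p -> 'rV[R]_q)
    (P : {linear 'rV[R]_k -> 'rV[R]_p}) (L : {linear 'rV[R]_k -> 'rV[R]_q}) w :
  smooth_near (P w) f ->
  smooth_near w (fun y => f (P y) + L y) /\
  forall v, 'd (fun y => f (P y) + L y) w v = 'd f (P w) (P v) + L v.
Proof.
move=> sf; have cL : continuous L by exact: linear_rV_continuous.
have cP : continuous P by exact: linear_rV_continuous.
have sl : smooth_near w (f \o P).
  by apply: smooth_near_comp => //; exact: smooth_near_lin.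
split.
  have [U oU sU] := sl; exists U => // j; apply: CkD; first by case: oU.
    exact: sU.
  exact: Ck_lin.
move=> v; have df := smooth_near_differentiable sf.
have dl := smooth_near_differentiable sl.
have dP := linear_differentiable w cP.
have dL := linear_differentiable w cL.
have e1 : 'd (f \o P) w v = 'd f (P w) (P v).
  by rewrite (diff_comp dP df) /comp (diff_lin w cP).
have e2 : 'd L w v = L v by rewrite (diff_lin w cL).
rewrite -e1 -e2; exact: (congr1 (fun h => h v) (diffD dl dL)).
Qed.

Lemma diff_lsubmx_sub n (f : 'rV[R]_n -> 'rV[R]_n) (z : 'rV[R]_n)
    (w : 'rV[R]_(n + 1)) : smooth_near (lsubmx w) f ->
  smooth_near w (fun w : 'rV[R]_(n + 1) => f (lsubmx w) - rsubmx w *m z) /\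
  forall v, 'd (fun w : 'rV[R]_(n + 1) => f (lsubmx w) - rsubmx w *m z) w
    (row_mx v 0) = 'd f (lsubmx w) v.
Proof.
move=> sf.
have -> : (fun w : 'rV[R]_(n + 1) => f (lsubmx w) - rsubmx w *m z) =
    fun w => f (lsubmx w) + (mulmxr (- z) \o rsubmx) w.
  by apply/funext => y; rewrite /= mulmxN.
have [h1 h2] := @diff_comp_linear _ _ _ f lsubmx (mulmxr (- z) \o rsubmx) w sf.
split=> // v; rewrite h2; rewrite -[X in X + _]/('d f (lsubmx w) (lsubmx (row_mx v 0))).
by rewrite row_mxKl -[X in _ + X]/(rsubmx (row_mx v 0) *m - z) row_mxKr mul0mx addr0.
Qed.

(** Solving f y - t *m z = const for y with parameter t gives the curve through
    the initial point along which f moves in the direction z. *)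
Lemma diff_row_mx_sub n (f : 'rV[R]_n -> 'rV[R]_n) (z : 'rV[R]_n) y (t : 'rV[R]_1) :
  smooth_near y f ->
  smooth_near (row_mx y t) (fun w : 'rV[R]_(n + 1) => f (lsubmx w) - rsubmx w *m z) /\
  forall v, 'd (fun w : 'rV[R]_(n + 1) => f (lsubmx w) - rsubmx w *m z)
    (row_mx y t) (row_mx v 0) = 'd f y v.
Proof.
move=> sf; have ly : lsubmx (row_mx y t) = y by rewrite row_mxKl.
by have := @diff_lsubmx_sub n f z (row_mx y t); rewrite ly; exact.
Qed.

Lemma partial_injective_near n l (E : 'rV[R]_(n + l) -> 'rV[R]_n) u r :
  smooth_near (row_mx u r) E ->
  (forall v, 'd E (row_mx u r) (row_mx v 0) = 0 -> v = 0) ->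
  \forall y \near u, forall v, 'd E (row_mx y r) (row_mx v 0) = 0 -> v = 0.
Proof.
move=> [U [oU Uu] sU] inj.
have Ju : partial_jacobian E (row_mx u r) \in unitmx.
  rewrite -row_free_unit; apply: inj_row_free => v.
  by rewrite partial_jacobianE; exact: inj.
have h := partial_jacobian_unit_near oU sU Uu Ju.
have cr : {for u, continuous (fun y => row_mx y r)}.
  by apply: row_mx_continuous; [exact: id_continuous_at|exact: cst_continuous].
have h' : \forall y \near u, partial_jacobian E (row_mx y r) \in unitmx.
  exact: cr _ h.
apply: filterS h' => y Jy v dv.
have vJ : v *m partial_jacobian E (row_mx y r) = 0.
  by rewrite partial_jacobianE.
by rewrite -(mulmxK Jy v) vJ mul0mx.
Qed.

(** The case z = 0 of the previous construction presents f as a map with a dummy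
    parameter, to which the openness of invertibility of the partial Jacobian
    matrix applies. *)
Lemma injective_differential_near n (f : 'rV[R]_n -> 'rV[R]_n) u :
  smooth_near u f -> (forall v, 'd f u v = 0 -> v = 0) ->
  \forall y \near u, forall v, 'd f y v = 0 -> v = 0.
Proof.
move=> sf inj; have [sE dE] := diff_row_mx_sub 0 0 sf.
have h := partial_injective_near sE (fun v => inj v \o etrans (esym (dE v))).
apply: filterS2 (smooth_near_near sf) h => y sy hy v fv.
have [_ dEy] := diff_row_mx_sub 0 0 sy.
by apply: hy; rewrite dEy.
Qed.

End diff_linear.

Section frames.
Context {R : realType} {m n : nat} {M : manifoldType R m} {G : lieGroupType R n}.
Variable rho : {multiplicative G -> Diff M}.
Hypothesis srho : dsmooth (manifold_diffeology G) (functional_diffeology M) rho.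
Variable c : chart R n G.
Hypothesis ac : atlas c.

Definition action_coord (x : M) (d : chart R m M) (i : 'I_m) : 'rV[R]_n -> R :=
  fun u => d (act rho (chart_inv c u, x)) 0 i.

Lemma act_chart_smooth x u : chart_cod c u ->
  smooth_at (fun u => act rho (chart_inv c u, x)) u.
Proof.
move=> cu; apply: (act_smooth_comp srho (b := fun=> x)).
  exact: smooth_at_chart_inv.
exact: smooth_at_cst.
Qed.

Lemma action_coord_smooth x d i u : chart_cod c u -> atlas d ->
  chart_dom d (act rho (chart_inv c u, x)) -> smooth_near u (action_coord x d i).
Proof.
by move=> cu ad dx; apply: smooth_at_chart_coord => //; exact: act_chart_smooth.
Qed.

(** Such an f is a system of local coordinates of G at the point c^-1 u, whose
    first s members are coordinates of orbit maps. *)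
Definition partial_action_frame s (f : 'rV[R]_n -> 'rV[R]_n) u :=
  [/\ chart_cod c u, smooth_near u f, forall v, 'd f u v = 0 -> v = 0 &
    forall j : 'I_n, (j < s)%N -> exists x d i, [/\ atlas d,
      chart_dom d (act rho (chart_inv c u, x)) &
      forall y, f y 0 j = action_coord x d i y]].

Lemma partial_frame0 u : chart_cod c u -> partial_action_frame 0 id u.
Proof.
move=> cu; split=> //; first exact: (smooth_near_lin idfun).
move=> v; have did : differentiable (id : 'rV[R]_n -> _) u by [].
by rewrite -(deriveE v did) derive_id.
Qed.

Lemma partial_frame_near s f u : partial_action_frame s f u ->
  \forall y \near u, partial_action_frame s f y.
Proof.
move=> [cu sf inj hf].
have n1 : \forall y \near u, chart_cod c y.
  by apply: open_nbhs_nbhs; split => //; exact: chart_cod_open.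
have n2 := smooth_near_near sf.
have n3 := injective_differential_near sf inj.
have n4 : \forall y \near u, forall j : 'I_n, (j < s)%N -> exists x d i,
    [/\ atlas d, chart_dom d (act rho (chart_inv c y, x)) &
    forall y, f y 0 j = action_coord x d i y].
  suff h (j : 'I_n) : \forall y \near u, (j < s)%N -> exists x d i,
    [/\ atlas d, chart_dom d (act rho (chart_inv c y, x)) &
    forall y, f y 0 j = action_coord x d i y] by exact: (filter_forall _ h).
  have [js|js] := boolP (j < s)%N; last by apply: filterS n1 => y.
  have [x [d [i [ad dx fj]]]] := hf j js.
  have [ca _] := act_chart_smooth x cu.
  have nd : \forall y \near u, chart_dom d (act rho (chart_inv c y, x)).
    exact: ca _ (chart_dom_nbhs dx).
  by apply: filterS nd => y dy _; exists x, d, i.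
near=> y; split; [near: y; exact: n1|near: y; exact: n2|near: y; exact: n3|].
by near: y; exact: n4.
Unshelve. all: by end_near. Qed.

End frames.

Section frame_extension.
Context {R : realType} {m n : nat} {M : manifoldType R m} {G : lieGroupType R n}.
Variable rho : {multiplicative G -> Diff M}.
Hypothesis srho : dsmooth (manifold_diffeology G) (functional_diffeology M) rho.
Variable c : chart R n G.
Hypothesis ac : atlas c.
Local Notation action_coord := (action_coord rho c).
Local Notation partial_action_frame := (partial_action_frame rho c).

(** Steinitz exchange for differentials: v is the vector dual to the j-th
    coordinate, so a function with nonzero derivative along v can replace it. *)
Lemma frame_exchange s f u (j : 'I_n) v x d i : j = s :> nat ->
  partial_action_frame s f u -> 'd f u v = delta_mx 0 j ->
  atlas d -> chart_dom d (act rho (chart_inv c u, x)) ->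
  'd (action_coord x d i) u v != 0 ->
  partial_action_frame s.+1
    (fun y => \row_k if k == j then action_coord x d i y else f y 0 k) u.
Proof.
move=> js [cu sf inj hf] fv ad dx v0.
pose f' := (fun y => \row_k if k == j then action_coord x d i y else f y 0 k).
have sa := action_coord_smooth srho ac i cu ad dx.
have f'j : (fun y => f' y 0 j) = action_coord x d i.
  by apply/funext => y; rewrite mxE eqxx.
have f'k k : k != j -> (fun y => f' y 0 k) = (fun y => f y 0 k).
  by move=> kj; apply/funext => y; rewrite mxE (negbTE kj).
have sf' : smooth_near u f'.
  apply: smooth_near_row => k; have [->|kj] := eqVneq k j.
    by rewrite f'j.
  by rewrite (f'k _ kj); exact: smooth_near_coord.
have df := smooth_near_differentiable sf.
have df' := smooth_near_differentiable sf'.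
split; [exact: cu|exact: sf'| |].
  move=> z z0.
  have az : 'd (action_coord x d i) u z = 0.
    by rewrite -f'j (diff_coord _ _ df') z0 mxE.
  have fz k : k != j -> 'd f u z 0 k = 0.
    by move=> kj; rewrite -(diff_coord _ _ df) -(f'k _ kj) (diff_coord _ _ df') z0 mxE.
  pose a := 'd f u z 0 j.
  have zE : z = a *: v.
    apply/eqP; rewrite -subr_eq0; apply/eqP/inj; rewrite linearB linearZ /= fv.
    apply/rowP => k; rewrite !mxE eqxx /=; have [->|kj] := eqVneq k j.
      by rewrite mulr1 subrr.
    by rewrite fz// mulr0 subr0.
  move: az; rewrite zE linearZ /= => /eqP; rewrite mulf_eq0 (negbTE v0) orbF.
  by move=> /eqP ->; rewrite scale0r.
move=> k; rewrite ltnS leq_eqVlt => /orP[/eqP kj|ks].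
  have -> : k = j by apply/val_inj; rewrite /= kj js.
  by exists x, d, i; split; [exact: ad|exact: dx|move=> y; rewrite mxE eqxx].
have [x' [d' [i' [ad' dx' fk]]]] := hf k ks.
exists x', d', i'; split; [exact: ad'|exact: dx'|move=> y]; rewrite mxE ifN ?fk//.
by apply: contraTneq ks => ->; rewrite js ltnn.
Qed.

Hypothesis irho : injective rho.

(** If no further coordinate of an orbit map can be added, then by the exchange
    lemma the derivatives of all of them vanish along the curve k that moves only
    the coordinate number s.  All orbit maps are then constant along it, hence by
    injectivity of rho so is the group element, although its coordinate number s
    increases at unit speed. *)
Lemma frame_step s f u : (s < n)%N -> partial_action_frame s f u ->
  exists f' u', partial_action_frame s.+1 f' u'.
Proof.
move=> sn pf; apply: contrapT => nframe.
have [cu sf inj hf] := pf.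
pose j := Ordinal sn; pose z : 'rV[R]_n := delta_mx 0 j.
(* The curve t |-> k t with f (k t) = f u + t *: z. *)
have [sE dE] := diff_row_mx_sub z 0 sf.
have [g [sg g0 gE]] := implicit_function sE (fun v => inj v \o etrans (esym (dE v))).
pose e1 : 'rV[R]_1 := 1%:M.
pose k (t : R) := g (t *: e1).
have cl : continuous (fun t : R => t *: e1).
  by move=> t; exact: cvgZr_tmp.
have k0 : k 0 = u by rewrite /k scale0r.
have cg0 : {for 0, continuous g} by exact: smooth_near_continuous.
have ck0 : {for 0, continuous k}.
  apply: (@continuous_comp _ _ _ (fun t : R => t *: e1) g); first exact: cl.
  by rewrite scale0r.
have lim0 : (t : R) *: e1 @[t --> (0 : R)] --> (0 : 'rV[R]_1).
  by have := cl 0; rewrite /continuous_at scale0r.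
have to0 (P : set 'rV[R]_1) : nbhs (0 : 'rV[R]_1) P ->
    \forall t \near (0 : R), P (t *: e1) by move=> nP; exact: lim0 nP.
have n1 : \forall t \near (0 : R), smooth_near (t *: e1) g.
  exact: to0 (smooth_near_near sg).
have n2 : \forall t \near (0 : R), partial_action_frame s f (k t).
  by apply: ck0; rewrite k0; exact: partial_frame_near.
have n3 : \forall t \near (0 : R), f (k t) = f u + t *: z.
  have := to0 _ gE; apply: filterS => t /=.
  rewrite !row_mxKl !row_mxKr mul0mx subr0 => <-.
  by rewrite -scalemxAl mul1mx subrK.
have /nbhs_ballP[e /= e0 eP] : \forall t \near (0 : R),
    [/\ smooth_near (t *: e1) g, partial_action_frame s f (k t) &
        f (k t) = f u + t *: z].
  by near=> t; split; near: t.
have be t : ball 0 e t -> nbhs t (ball (0 : R) e).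
  by move=> te; apply: open_nbhs_nbhs; split=> //; exact: ball_open.
have dk t : ball 0 e t -> differentiable k t.
  move=> /eP[sgt _ _]; have dl : differentiable (fun t : R => t *: e1) t by [].
  have dg := smooth_near_differentiable sgt.
  exact: (differentiable_comp dl dg).
pose v t := 'd k t (1 : R).
have fv t : ball 0 e t -> 'd f (k t) (v t) = z.
  move=> te; have [_ [_ sft _ _] _] := eP _ te.
  have dft := smooth_near_differentiable sft.
  have dfk : differentiable (f \o k) t by apply: differentiable_comp => //; exact: dk.
  have -> : 'd f (k t) (v t) = 'D_1 (f \o k) t.
    by rewrite deriveE// (diff_comp (dk _ te) dft).
  have : \forall s \near t, (f \o k) s = f u + s *: z.
    by apply: filterS (be _ te) => t' /eP[].
  move=> /near_eq_derive ->.
  rewrite deriveD; last 2 first.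
  - exact: derivable_cst.
  - by apply: diff_derivable; have [] := is_diff_scalel t z.
  have [dz dzE] := is_diff_scalel t z.
  by rewrite derive_cst add0r (deriveE _ dz) dzE scale1r.
have av t x d i : ball 0 e t -> atlas d ->
    chart_dom d (act rho (chart_inv c (k t), x)) ->
    'd (action_coord x d i) (k t) (v t) = 0.
  move=> te ad dx; have [_ pft _] := eP _ te.
  apply/eqP/negPn/negP => nz; apply: nframe.
  exists (fun y => \row_k if k == j then action_coord x d i y else f y 0 k), (k t).
  exact: (frame_exchange _ pft (fv _ te)).
pose p x t := act rho (chart_inv c (k t), x).
have pcst x t : ball 0 e t -> \forall s \near t, p x s = p x t.
  move=> te; have [d ad dx] := atlas_cover (p x t).
  apply: (path_locally_constant dx).
    have ckt0 : {for t, continuous k} by exact: differentiable_continuous (dk _ te).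
    apply: (@continuous_comp _ _ _ k (fun u => act rho (chart_inv c u, x))) => //.
    have [_ [ckt _ _ _] _] := eP _ te.
    exact: (act_chart_smooth srho ac x ckt).1.
  have /nbhs_ballP[e' /= e'0 e'P] := be _ te.
  exists e' => // a b i ab H.
  apply: (@zero_derivative_segment _ (fun t => d (p x t) 0 i)) => // t' /H[/e'P te' dx'].
  have [_ [ckt' _ _ _] _] := eP _ te'.
  have sa := action_coord_smooth srho ac i ckt' ad dx'.
  have da := smooth_near_differentiable sa.
  have dak : differentiable (action_coord x d i \o k) t'.
    by apply: differentiable_comp => //; exact: dk.
  apply: DeriveDef; first exact: diff_derivable.
  by rewrite deriveE// (diff_comp (dk _ te') da) /comp (av _ _ _ _ te' ad dx').
pose h := e / 2; have h0 : 0 < h by rewrite divr_gt0.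
have bh t : 0 <= t <= h -> ball 0 e t.
  move=> /andP[t0 th]; rewrite -ball_normE /= sub0r normrN ger0_norm//.
  by rewrite (le_lt_trans th)// ltr_pdivrMr// ltr_pMr// ltr1n.
have b0 : ball (0 : R) e 0 by exact: ballxx.
have b1 : ball (0 : R) e h by apply: bh; rewrite lexx ltW.
have rE : rho (chart_inv c (k h)) = rho (chart_inv c (k 0)).
  apply: Diff_eq => x; apply: (@locally_constant_segment _ _ (p x)) => [|t th].
    exact: ltW.
  exact/pcst/bh.
have [_ [c0 _ _ _] f0] := eP _ b0; have [_ [c1 _ _ _] f1] := eP _ b1.
have kE : k h = k 0 by rewrite -(chart_invK c1) (irho rE) chart_invK.
have : h *: z = 0.
  by apply: (addrI (f u)); rewrite -f1 kE f0 scale0r.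
move=> /rowP/(_ j); rewrite !mxE !eqxx mulr1 => h00.
by rewrite h00 ltxx in h0.
Unshelve. all: by end_near. Qed.

Lemma frame_exists u0 : chart_cod c u0 ->
  exists f u, partial_action_frame n f u.
Proof.
move=> cu0.
suff h s : (s <= n)%N -> exists f u, partial_action_frame s f u by exact: h.
elim: s => [_|s IH sn].
  by exists id, u0; exact: partial_frame0.
have [f [u pf]] := IH (ltnW sn); exact: frame_step pf.
Qed.

(** The point u is produced together with the frame; it need not be the initial
    point u0, because each extension step moves along a curve. *)
Lemma action_coords_independent u0 : chart_cod c u0 ->
  exists u (x : 'I_n -> M) (d : 'I_n -> chart R m M) (i : 'I_n -> 'I_m),
  [/\ chart_cod c u,
    forall j, atlas (d j) /\ chart_dom (d j) (act rho (chart_inv c u, x j)) &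
    forall v, (forall j, 'd (action_coord (x j) (d j) (i j)) u v = 0) -> v = 0].
Proof.
move=> /frame_exists[f [u [cu sf inj hf]]].
have /choice[F hF] (j : 'I_n) : exists p : M * chart R m M * 'I_m,
    [/\ atlas p.1.2, chart_dom p.1.2 (act rho (chart_inv c u, p.1.1)) &
    forall y, f y 0 j = action_coord p.1.1 p.1.2 p.2 y].
  have [x [d [i H]]] := hf j (ltn_ord j); by exists (x, d, i).
exists u, (fun j => (F j).1.1), (fun j => (F j).1.2), (fun j => (F j).2).
split; [exact: cu|by move=> j; have [? ? _] := hF j|].
move=> v v0; apply: inj; apply/rowP => j.
rewrite -(diff_coord _ _ (smooth_near_differentiable sf)) mxE.
have -> : (fun y => f y 0 j) = action_coord (F j).1.1 (F j).1.2 (F j).2.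
  by apply/funext => y; have [_ _ ->] := hF j.
exact: v0.
Qed.

End frame_extension.

(** * Local injectivity, uniformly in the points of M *)

Lemma discrete_countable (T : topologicalType) (Z : set T) :
  @second_countable T ->
  (forall g, Z g -> exists2 N, nbhs g N & forall g', Z g' -> N g' -> g' = g) ->
  countable Z.
Proof.
move=> [B cB [_ bB]] dZ.
have [->|/set0P[g0 _]] := eqVneq Z set0; first exact: countable0.
pose p U := xget g0 (Z `&` U).
apply: (@sub_countable _ _ _ (p @` B)); last first.
  by apply: sub_countable cB; exact: card_image_le.
apply: subset_card_le => g Zg; have [N nN uN] := dZ g Zg.
have [U [BU Ug] UN] := bB g N nN.
exists U => //; rewrite /p; case: xgetP => [g' _ [Zg' Ug']|/(_ g)[]//].
exact/uN/UN.
Qed.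

Section partial_differential.
Context {R : realType}.

Lemma diff_row_mxl p k (W : normedModType R) (F : 'rV[R]_(p + k) -> W) u a v :
  differentiable F (row_mx u a) ->
  'd F (row_mx u a) (row_mx v 0) = 'd (fun y => F (row_mx y a)) u v.
Proof.
move=> dF; pose P y := row_mx y a : 'rV[R]_(p + k).
have [dP dPE] : differentiable P u /\ 'd P u = row_mxl p k :> (_ -> _).
  apply: differentiable_from_near => e e0.
  have n1 : nbhs (0 : 'rV[R]_p) (ball (0 : 'rV[R]_p) 1) by exact: nbhsx_ballx.
  apply: filterS n1 => h _.
  rewrite /P opp_row_mx add_row_mx addrK subrr subrr normr0 mulr_ge0//.
  exact: ltW.
have -> : (fun y => F (row_mx y a)) = F \o P by [].
by rewrite (diff_comp dP dF) /comp dPE.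
Qed.

End partial_differential.

Section uniform_injectivity.
Context {R : realType} {m n : nat} {M : manifoldType R m} {G : lieGroupType R n}.
Variable rho : {multiplicative G -> Diff M}.
Hypothesis srho : dsmooth (manifold_diffeology G) (functional_diffeology M) rho.
Variable c : chart R n G.
Hypothesis ac : atlas c.
Variables (u0 : 'rV[R]_n) (x : 'I_n -> M) (d : 'I_n -> chart R m M) (i : 'I_n -> 'I_m).
Hypothesis cu0 : chart_cod c u0.
Hypothesis hd : forall j, atlas (d j) /\ chart_dom (d j) (act rho (chart_inv c u0, x j)).
Hypothesis inj :
  forall v, (forall j, 'd (action_coord rho c (x j) (d j) (i j)) u0 v = 0) -> v = 0.

(** Quantitative form of the independence of the n differentials. *)
Lemma gradients_bound : exists2 C, 0 < C & forall v e, 0 <= e ->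
  (forall j, `|'d (action_coord rho c (x j) (d j) (i j)) u0 v| <= e) -> `|v| <= C * e.
Proof.
pose A : 'M[R]_n := \matrix_(k, j)
  'd (action_coord rho c (x j) (d j) (i j)) u0 (delta_mx 0 k).
have AE v j : (v *m A) 0 j = 'd (action_coord rho c (x j) (d j) (i j)) u0 v.
  rewrite mxE {2}(row_sum_delta v) linear_sum; apply: eq_bigr => k _.
  by rewrite linearZ mxE.
have Au : A \in unitmx.
  rewrite -row_free_unit; apply: inj_row_free => v vA; apply: inj => j.
  by rewrite -AE vA mxE.
have [C C0 CA] := norm_mulmx_le (invmx A).
exists C => // v e e0 ve; rewrite -(mulmxK Au v) (le_trans (CA _))//.
rewrite ler_wpM2l ?(ltW C0)//; apply: norm_le_coord => // j.
by rewrite AE.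
Qed.

(** Strict differentiability in (u, y) jointly makes the neighbourhood of u0 on
    which the n coordinates are injective independent of the points y_j near x_j:
    if u and u' have the same coordinates, then each differential is at most
    e * |u - u'| on u - u', so that |u - u'| <= C e |u - u'| with C e = 1/2. *)
Lemma action_coord_uniformly_injective :
  exists U (W : 'I_n -> set M), [/\ open_nbhs u0 U, forall j, nbhs (x j) (W j) &
    forall u u' y, U u -> U u' -> (forall j, W j (y j)) ->
    (forall j, action_coord rho c (y j) (d j) (i j) u =
               action_coord rho c (y j) (d j) (i j) u') -> u = u'].
Proof.
have [C C0 CB] := gradients_bound.
have /choice[b bP] j : exists b, atlas b /\ chart_dom b (x j).
  by have [b ab bx] := atlas_cover (x j); exists b.
pose E j (w : 'rV[R]_(n + m)) :=
  action_coord rho c (chart_inv (b j) (rsubmx w)) (d j) (i j) (lsubmx w).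
pose w0 j : 'rV[R]_(n + m) := row_mx u0 (b j (x j)).
have xE j : chart_inv (b j) (b j (x j)) = x j.
  by rewrite chart_funK//; have [] := bP j.
have sE j : smooth_near (w0 j) (E j).
  have [ad dx] := hd j; have [ab bx] := bP j.
  apply: (smooth_at_chart_coord (f := fun w => act rho
     (chart_inv c (lsubmx w), chart_inv (b j) (rsubmx w)))) => //.
    by rewrite /w0 row_mxKl row_mxKr xE.
  apply: (act_smooth_comp srho (a := chart_inv c \o lsubmx)
     (b := chart_inv (b j) \o rsubmx)).
    apply: (@smooth_at_comp _ _ _ _ _ _ _ lsubmx (chart_inv c)).
      by apply: smooth_at_rV; exact: smooth_near_lin.
    by rewrite row_mxKl; exact: smooth_at_chart_inv.
  apply: (@smooth_at_comp _ _ _ _ _ _ _ rsubmx (chart_inv (b j))).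
    by apply: smooth_at_rV; exact: smooth_near_lin.
  by rewrite row_mxKr; apply: smooth_at_chart_inv => //; exact: chart_funS.
have dE j v : 'd (E j) (w0 j) (row_mx v 0) =
    'd (action_coord rho c (x j) (d j) (i j)) u0 v.
  rewrite /w0 diff_row_mxl; last exact: smooth_near_differentiable (sE j).
  suff -> : (fun y => E j (row_mx y (b j (x j)))) =
    action_coord rho c (x j) (d j) (i j) by [].
  by apply/funext => y; rewrite /E row_mxKl row_mxKr xE.
pose e := 2^-1 / C; have e0 : 0 < e by rewrite divr_gt0.
have /choice[t tP] j : exists t, 0 < t /\ forall w w', ball (w0 j) t w ->
    ball (w0 j) t w' -> `|E j w - E j w' - 'd (E j) (w0 j) (w - w')| <= e * `|w - w'|.
  by have [t t0 h] := strictly_differentiable (sE j) e0; exists t.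
have nt : \forall s \near (0 : R)^'+, forall j, s <= t j.
  suff h (j : 'I_n) : \forall s \near (0 : R)^'+, s <= t j by exact: (filter_forall _ h).
  by apply: nbhs_right_le; have [] := tP j.
near (0 : R)^'+ => s.
have s0 : 0 < s by [].
have st j : s <= t j by move: j; near: s.
pose s2 := s / 2; have s20 : 0 < s2 by rewrite divr_gt0.
have bw j u z : ball u0 s2 u -> ball (b j (x j)) s2 z -> ball (w0 j) (t j) (row_mx u z).
  move=> us zs; apply: (@le_ball _ _ _ s) => //; move: us zs.
  rewrite -!ball_normE /= /w0 opp_row_mx add_row_mx => us zs.
  by rewrite (le_lt_trans (norm_row_mx _ _))// (splitr s) ltrD.
exists (ball u0 s2), (fun j => chart_dom (b j) `&` (b j @^-1` ball (b j (x j)) s2)).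
split.
- by split; [exact: ball_open|exact: ballxx].
- move=> j; have [ab bx] := bP j; apply: filterI; first exact: chart_dom_nbhs.
  by apply: (chart_fun_continuous bx); exact: nbhsx_ballx.
move=> u u' y us us' Wy fE.
have h j : `|'d (action_coord rho c (x j) (d j) (i j)) u0 (u - u')| <= e * `|u - u'|.
  have [by_ yb] := Wy j.
  have [_ /(_ _ _ (bw j _ _ us yb) (bw j _ _ us' yb))] := tP j.
  rewrite /E !row_mxKl !row_mxKr (chart_funK by_) fE subrr sub0r normrN.
  rewrite opp_row_mx add_row_mx subrr dE => /le_trans; apply.
  by rewrite ler_wpM2l ?(ltW e0)// norm_row_mx0.
have := CB _ _ _ h; rewrite mulrA.
have -> : C * e = 2^-1 by rewrite /e mulrCA divff ?mulr1// gt_eqF.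
move=> h2; apply/eqP; rewrite -subr_eq0 -normr_le0.
have := h2 (mulr_ge0 (ltW e0) (normr_ge0 _)); lra.
Unshelve. all: by end_near. Qed.

End uniform_injectivity.

(** * Lifting smooth families of diffeomorphisms *)

Section lifting.
Context {R : realType} {m n : nat} {M : manifoldType R m} {G : lieGroupType R n}.
Variable rho : {multiplicative G -> Diff M}.
Hypothesis srho : dsmooth (manifold_diffeology G) (functional_diffeology M) rho.
Hypothesis irho : injective rho.

Lemma rho_eq g h : (forall x, act rho (g, x) = act rho (h, x)) -> g = h.
Proof. by move=> gh; apply/irho/Diff_eq. Qed.

Lemma act1 x : act rho (1%g, x) = x.
Proof.
apply: (can_inj (Diff_funK (rho 1%g))).
by rewrite -[LHS]/(act rho (1%g, act rho (1%g, x))) -act_mul mulg1.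
Qed.

Lemma mulg_smooth_at k (a b : 'rV[R]_k -> G) r :
  smooth_at a r -> smooth_at b r -> smooth_at (fun y => (a y * b y)%g) r.
Proof.
move=> sa sb; apply: (@smooth_at_comp _ _ _ _ _ _ _ (fun z => (a z, b z))
  (fun p : G * G => (p.1 * p.2)%g)).
  exact: smooth_at_pair.
exact: mulg_smooth.
Qed.

Lemma mulg_smoothr (h : G) g : smooth_at (fun y : G => (y * h)%g) g.
Proof.
apply: (@smooth_at_comp _ _ _ _ _ _ _ (fun z : G => (z, h))
  (fun p : G * G => (p.1 * p.2)%g)).
  by apply: smooth_at_pair; [exact: smooth_at_id|exact: smooth_at_cst].
exact: mulg_smooth.
Qed.

Lemma orbit_map_smooth l (q : 'rV[R]_l -> G) r x :
  smooth_at (fun p : 'rV[R]_l * M => act rho (q p.1, p.2)) (r, x) ->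
  smooth_at (fun s => act rho (q s, x)) r.
Proof.
move=> h; apply: (@smooth_at_comp _ _ _ _ _ _ _ (fun s : 'rV[R]_l => (s, x))
  (fun p => act rho (q p.1, p.2))) => //.
by apply: smooth_at_pair; [exact: smooth_at_id|exact: smooth_at_cst].
Qed.

(** The equations for k r are those of the chosen coordinates at the moved points
    rho (q r * (q r0)^-1) x_j, which agree with x_j at r0. *)
Lemma implicit_correction l (q : 'rV[R]_l -> G) r0
    (c : chart R n G) (u0 : 'rV[R]_n)
    (x : 'I_n -> M) (d : 'I_n -> chart R m M) (i : 'I_n -> 'I_m) :
  (forall z, smooth_at (fun s => act rho (q s, z)) r0) ->
  atlas c -> chart_cod c u0 ->
  (forall j, atlas (d j) /\ chart_dom (d j) (act rho (chart_inv c u0, x j))) ->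
  (forall v, (forall j, 'd (action_coord rho c (x j) (d j) (i j)) u0 v = 0) ->
    v = 0) ->
  exists k : 'rV[R]_l -> 'rV[R]_n, [/\ smooth_near r0 k, k r0 = u0 &
    \forall r \near r0, forall j,
      action_coord rho c (act rho ((q r * (q r0)^-1)%g, x j)) (d j) (i j) (k r) =
      action_coord rho c (x j) (d j) (i j) u0].
Proof.
move=> sq ac cu0 hd inj.
pose y j r := act rho ((q r * (q r0)^-1)%g, x j).
have y0 j : y j r0 = x j by rewrite /y mulgV act1.
have sy j : smooth_at (y j) r0.
  have -> : y j = fun r => act rho (q r, act rho ((q r0)^-1%g, x j)).
    by apply/funext => r; rewrite /y act_mul.
  exact: sq.
pose E (w : 'rV[R]_(n + l)) :=
  \row_j action_coord rho c (y j (rsubmx w)) (d j) (i j) (lsubmx w).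
pose w0 : 'rV[R]_(n + l) := row_mx u0 r0.
have sEj j : smooth_near w0
    (fun w => action_coord rho c (y j (rsubmx w)) (d j) (i j) (lsubmx w)).
  have [ad dx] := hd j.
  apply: (smooth_at_chart_coord (f := fun w => act rho
     (chart_inv c (lsubmx w), y j (rsubmx w)))) => //.
    by rewrite /w0 row_mxKl row_mxKr y0.
  apply: (act_smooth_comp srho (a := chart_inv c \o lsubmx) (b := y j \o rsubmx)).
    apply: (@smooth_at_comp _ _ _ _ _ _ _ lsubmx (chart_inv c)).
      by apply: smooth_at_rV; exact: smooth_near_lin.
    by rewrite row_mxKl; exact: smooth_at_chart_inv.
  apply: (@smooth_at_comp _ _ _ _ _ _ _ rsubmx (y j)).
    by apply: smooth_at_rV; exact: smooth_near_lin.
  by rewrite row_mxKr.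
have EE j : (fun w => E w 0 j) =
    fun w => action_coord rho c (y j (rsubmx w)) (d j) (i j) (lsubmx w).
  by apply/funext => w; rewrite mxE.
have sE : smooth_near w0 E.
  by apply: smooth_near_row => j; rewrite EE.
have injE v : 'd E w0 (row_mx v 0) = 0 -> v = 0.
  move=> Ev; apply: inj => j.
  have := diff_row_mxl v (smooth_near_differentiable (sEj j)).
  rewrite -/w0 -[X in 'd X w0]EE.
  rewrite (diff_coord _ _ (smooth_near_differentiable sE)) Ev mxE => ->.
  suff -> : (fun u => action_coord rho c (y j (rsubmx (row_mx u r0))) (d j) (i j)
      (lsubmx (row_mx u r0))) = action_coord rho c (x j) (d j) (i j) by [].
  by apply/funext => u; rewrite row_mxKl row_mxKr y0.
have [k [sk k0 kE]] := implicit_function sE injE.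
exists k; split; [exact: sk|exact: k0|].
apply: filterS kE => r rE j; have := congr1 (fun M : 'rV_n => M 0 j) rE.
by rewrite !mxE !row_mxKl !row_mxKr y0.
Qed.

(** Multiplication by the smooth correction c^-1 (k r) makes q locally constant. *)
Lemma lift_smooth l (q : 'rV[R]_l -> G) (U : set 'rV[R]_l) r0 :
  (forall r x, U r ->
    smooth_at (fun p : 'rV[R]_l * M => act rho (q p.1, p.2)) (r, x)) ->
  open U -> U r0 -> smooth_at q r0.
Proof.
move=> sqU oU Ur0.
have sq r x : U r -> smooth_at (fun s => act rho (q s, x)) r.
  by move=> Ur; apply: orbit_map_smooth; exact: sqU.
have [c ac c1] := atlas_cover (1%g : G).
have [u0 [x [d [i [cu0 hd inj]]]]] :=
  action_coords_independent srho ac irho (chart_funS c1).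
have [V [W [[oV Vu0] nW VW]]] :=
  action_coord_uniformly_injective srho ac cu0 hd inj.
have [k [sk k0 kE]] :=
  implicit_correction (fun z => sq r0 z Ur0) ac cu0 hd inj.
pose y j r := act rho ((q r * (q r0)^-1)%g, x j).
have y0 j : y j r0 = x j by rewrite /y mulgV act1.
have n1 : \forall r \near r0, U r by exact: open_nbhs_nbhs.
have n2 := smooth_near_near sk.
have ck := smooth_near_continuous sk.
have n3 : \forall r \near r0, chart_cod c (k r).
  by apply: ck; rewrite k0; apply: open_nbhs_nbhs; split=> //; exact: chart_cod_open.
have n4 : \forall r \near r0, V (k r).
  by apply: ck; rewrite k0; exact: open_nbhs_nbhs.
have n5 : \forall r \near r0, forall j, W j (y j r).
  suff h (j : 'I_n) : \forall r \near r0, W j (y j r) by exact: (filter_forall _ h).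
  have yE : y j = fun r => act rho (q r, act rho ((q r0)^-1%g, x j)).
    by apply/funext => r; rewrite /y act_mul.
  have [cy _] : smooth_at (y j) r0 by rewrite yE; exact: sq.
  by apply: cy; rewrite y0; exact: nW.
have /nbhs_ballP[e /= e0 eP] : \forall r \near r0, [/\ U r, smooth_near r k,
    chart_cod c (k r), V (k r) & (forall j, W j (y j r)) /\
    forall j, action_coord rho c (y j r) (d j) (i j) (k r) =
      action_coord rho c (x j) (d j) (i j) u0].
  by near=> r; split; [near: r|near: r|near: r|near: r|split; near: r].
pose h r := (chart_inv c (k r) * q r)%g.
(* If h r' is close to h r, write h r' = c^-1 u' * q r; then u' and k r are two
   solutions of the same equations, with the points y j r. *)
have hd' r : ball r0 e r -> exists2 N, nbhs (h r) N &
    forall r', ball r0 e r' -> N (h r') -> h r' = h r.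
  move=> re; have [Ur _ ckr Vkr [Wr kr]] := eP _ re.
  pose f g := (g * (q r)^-1)%g.
  have fh : f (h r) = chart_inv c (k r) by rewrite /f /h mulgK.
  have [cf _] := mulg_smoothr (q r)^-1%g (h r).
  exists [set g | chart_dom c (f g) /\ V (c (f g))].
    have cfh : chart_dom c (f (h r)) by rewrite fh; exact: chart_invS.
    have cV : nbhs (f (h r)) (c @^-1` V).
      apply: (chart_fun_continuous cfh); rewrite fh chart_invK//.
      exact: open_nbhs_nbhs.
    exact: cf _ (filterI (chart_dom_nbhs cfh) cV).
  move=> r' r'e [cf' Vf']; have [_ _ ckr' Vkr' [Wr' kr']] := eP _ r'e.
  have yf j : action_coord rho c (y j r) (d j) (i j) (c (f (h r'))) =
      action_coord rho c (y j r') (d j) (i j) (k r').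
    rewrite /action_coord chart_funK// /y -!act_mul; congr (d j (act rho (_, _)) 0 _).
    by rewrite /f /h -!mulgA mulKg.
  have : k r = c (f (h r')).
    apply: (VW _ _ _ Vkr Vf' Wr) => j.
    by rewrite yf kr kr'.
  move=> /(congr1 (chart_inv c)); rewrite chart_funK// -fh => /mulIg ->.
  by [].
have cth : countable (h @` ball r0 e).
  apply: discrete_countable; first exact: manifold_second_countable.
  move=> _ [r re <-]; have [N nN uN] := hd' r re; exists N => // _ [r' r'e <-].
  exact: uN.
(* Countability replaces a continuity argument: h is not known to be continuous,
   only its action on each point z is. *)
have hcst r : ball r0 e r -> h r = h r0.
  move=> re; apply: rho_eq => z.
  apply: (@countable_continuous_const _ _ M l (fun r => act rho (h r, z)) r0 e) => //.
    move=> s se; have [Us sks cks _ _] := eP _ se.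
    have -> : (fun r => act rho (h r, z)) =
        fun r => act rho (chart_inv c (k r), act rho (q r, z)).
      by apply/funext => t; rewrite /h act_mul.
    apply: (act_smooth_comp srho _ (sq _ _ Us)).1.
    apply: (@smooth_at_comp _ _ _ _ _ _ _ k (chart_inv c)).
      exact: smooth_at_rV.
    exact: smooth_at_chart_inv.
  have -> : (fun r => act rho (h r, z)) = (fun g => act rho (g, z)) \o h by [].
  by rewrite -image_comp; apply: sub_countable cth; exact: card_image_le.
apply: (@smooth_at_eq _ _ _ _ _ (fun r => ((chart_inv c (k r))^-1 * h r0)%g)).
  apply/nbhs_ballP; exists e => // r /hcst <-.
  by rewrite /h mulKg.
apply: mulg_smooth_at; last exact: smooth_at_cst.
apply: (@smooth_at_comp _ _ _ _ _ _ _ (fun r => chart_inv c (k r)) (fun g : G => g^-1%g)).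
  apply: (@smooth_at_comp _ _ _ _ _ _ _ k (chart_inv c)).
    exact: smooth_at_rV.
  by apply: smooth_at_chart_inv => //; rewrite k0.
exact: invg_smooth.
Unshelve. all: by end_near. Qed.

End lifting.

Theorem mainTheorem1 (R : realType) (m n : nat)
    (M : manifoldType R m) (G : lieGroupType R n)
    (rho : {multiplicative G -> Diff M}) :
  injective rho ->
  dsmooth (manifold_diffeology G) (functional_diffeology M) rho ->
  is_induction (manifold_diffeology G) (functional_diffeology M) rho.
Proof.
move=> irho srho; split=> //.
have /choice[g gP] (f : range rho) : exists g, rho g = set_val f.
  by have [a _ af] := set_mem (valP f); exists a.
exists g; split.
- by move=> a; apply: irho; rewrite gP.
- by move=> f; apply: val_inj; rewrite /= gP.
- by move=> l U p /srho.
move=> l U p [oU sp]; split=> // r Ur; apply: (lift_smooth srho irho _ oU Ur).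
move=> s x Us; have := sp s x Us.
suff -> : (fun q : 'rV[R]_l * M => (set_val \o p) q.1 q.2) =
  (fun q => act rho ((g \o p) q.1, q.2)) by [].
by apply/funext => q; rewrite /act /= gP.
Qed.
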